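(* Let $r\ge 4$ be a constant integer. Then, with high probability, $rc(G(n,r))=O(\log n)$. That is, there is a constant $C=C(r)$ such that $$\lim_{n\to\infty}\Pr\big(rc(G(n,r))\le C\log n\big)=1,$$ where the limit is over those $n$ for which $rn$ is even.
   Context: $G(n,r)$ denotes the random $r$-regular graph of order $n$, i.e. a graph chosen uniformly at random from all simple $r$-regular graphs on the vertex set $[n]=\{1,\dots,n\}$ (with $rn$ even). A set of edges of an edge colored graph is rainbow colored if its members have pairwise distinct colors; the coloring is an arbitrary assignment of colors to edges (not required to be proper). An edge colored graph $G$ is rainbow edge connected if any two vertices are connected by a path whose edges have pairwise distinct colors. The rainbow connection $rc(G)$ of a connected graph $G$ is the smallest number of colors needed in an edge coloring that makes $G$ rainbow edge connected; for a disconnected graph set $rc(G)=\infty$, so the event $rc(G)\le C\log n$ includes that $G$ is connected. An event $\mathcal{E}_n$ occurs with high probability if $\lim_{n\to\infty}\Pr(\mathcal{E}_n)=1$. *)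

(* Defs.v *)
From mathcomp Require Import all_boot all_order all_algebra.
From mathcomp Require Import all_classical all_reals all_analysis.

Set Implicit Arguments.
Unset Strict Implicit.
Unset Printing Implicit Defensive.

Import Order.TTheory GRing.Theory Num.Theory.
Import numFieldNormedType.Exports.

Local Open Scope classical_set_scope.
Local Open Scope ring_scope.

(* A labelled simple graph on the vertex set 'I_n is identified with its edge
   set, a set of 2-element subsets of 'I_n (see [is_graph]); Leibniz equality
   of edge sets is thus equality of labelled graphs. *)
Definition edge_set (n : nat) := {set {set 'I_n}}.

Definition is_graph n (E : edge_set n) : bool := [forall e in E, #|e| == 2%N].

Definition adj n (E : edge_set n) : rel 'I_n :=
  fun x y => [set x; y]%SET \in E.

Definition degree n (E : edge_set n) (x : 'I_n) : nat :=
  #|[set e in E | x \in e]%SET|.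

Definition regular_graphs (n r : nat) : {set edge_set n} :=
  [set E : edge_set n | is_graph E & [forall x, degree E x == r]]%SET.

(* The path visits the vertices x :: p in this order. *)
Definition path_edges n (x : 'I_n) (p : seq 'I_n) : seq {set 'I_n} :=
  pairmap (fun u v => [set u; v]%SET) x p.

Definition rainbow_path n (E : edge_set n) (c : {set 'I_n} -> nat)
    (x : 'I_n) (p : seq 'I_n) : bool :=
  [&& path (adj E) x p, uniq (x :: p) & uniq (map c (path_edges x p))].

Definition rainbow_connected n (E : edge_set n) (c : {set 'I_n} -> nat) : Prop :=
  forall x y : 'I_n, exists p : seq 'I_n, rainbow_path E c x p /\ last x p = y.

(* The colors are 0, ..., k-1; the values of c outside E are irrelevant. *)
Definition rainbow_colorable n (E : edge_set n) (k : nat) : Prop :=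
  exists c : {set 'I_n} -> nat,
    (forall e, e \in E -> (c e < k)%N) /\ rainbow_connected E c.

(* The infimum of a nonempty set of naturals is its minimum.  No coloring of a
   disconnected graph is rainbow connected, and ereal_inf set0 = +oo. *)
Definition rc (R : realType) n (E : edge_set n) : \bar R :=
  ereal_inf [set (k%:R)%:E | k in [set k : nat | rainbow_colorable E k]].

(* The probability, for G(n, r), of the set A of graphs.  It is 0 / 0 = 0 when
   there is no r-regular graph of order n. *)
Definition Pr_regular (R : realType) (n r : nat) (A : {set edge_set n}) : R :=
  #|(regular_graphs n r :&: A)%SET|%:R / #|regular_graphs n r|%:R.

(* Main.v *)
Require Import Defs.
From mathcomp Require Import all_boot all_order all_algebra zify ring lra.

(* For a suitable constant t, with high probability every set X of at most half of the vertices of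
   G(n, r) is left by at least 2 (|X| %/ t + 1) edges.  This follows from a first moment
   computation based on switchings: the pairs of an r-regular graph E and a set of m edges of E
   inside X are compared for m + 1 and m by replacing a marked edge uv and another edge xy by ux
   and vy, which bounds the number of graphs with many edges inside X.

   Such expansion implies that C log n colors suffice.  A breadth-first tree has depth O(log n).
   Cutting off a branch of linear but not too large size, the tree paths from the edges leaving
   the branch form a core of linear size, which the depths of the tree color rainbow with
   O(log n) colors: among two vertices of the same side, the shallower one climbs to the top while
   the deeper one first descends to an edge leaving the branch.  The core is then grown by ears
   of bounded length, that is paths outside the core attached to it at both ends.  By expansion,
   disjoint ears cover a constant fraction of the remaining vertices, and one generation of ears
   costs a constant number of colors, so O(log n) generations reach every vertex. *)

Set Implicit Arguments.
Unset Strict Implicit.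
Unset Printing Implicit Defensive.

(** * Rainbow walks *)

(** The hypothesis r >= 4 comes from the first moment. A set of s vertices that fails to expand
    contains nearly r s / 2 edges, and up to small exponential factors this has probability at most
    'C(n, s)^-2 as soon as r >= 4; the choice of the set costs one factor 'C(n, s), and the other
    one is left over. The two terms of the expansion have different purposes. The quotient |X| %/ t
    gives logarithmic diameter and linear cuts; the + 1 gives two outgoing edges even to the
    smallest sets, so that no part of the graph hangs on a single edge. This matters because a tree
    colored by depth is not enough: the ascents of two vertices clash. Each vertex needs two ways
    out with disjoint colors. In the core these are the way up and the way down across the boundary
    of the branch; on an ear they are its two ends. Since the second way out of an ear is
    independent of which ear it is, all ears of one generation share the same colors. *)

Lemma simple_subwalk n (e : rel 'I_n) x p :
  path e x p -> exists p', [/\ path e x p', uniq (x :: p'), last x p' = last x p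
    & subseq (path_edges x p') (path_edges x p)].
Proof.
elim: p x => [|y q IHq] x; first by exists [::].
rewrite [path _ _ _]/= => /andP[exy /IHq [q' [pq' uq' lq' sq']]].
have sub s : subseq s (path_edges y q') -> subseq s (path_edges x (y :: q)).
  by move=> ss; apply: subseq_trans (subseq_cons _ _); apply: subseq_trans sq'.
have [xin|xnin] := boolP (x \in y :: q'); last first.
  exists (y :: q'); split; rewrite ?[path _ _ _]/= ?exy //.
    by rewrite cons_uniq xnin.
  by rewrite /= eqxx.
move: xin; rewrite inE; case: (eqVneq x y) => [xy _|_ xq'].
  by rewrite xy in sub *; exists q'; split=> //; apply: sub.
move: pq' uq' lq' sub {sq'}; case/splitPr: xq' => q1 q2.
rewrite cat_path last_cat => /and3P[_ _ pq2].
rewrite cons_uniq cat_uniq => /and4P[_ _ _ uq2] lq2 sub.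
exists q2; split=> //; apply: sub.
rewrite /path_edges pairmap_cat.
by apply: subseq_trans (suffix_subseq _ _); apply: subseq_cons.
Qed.

Lemma path_edges_rev n (x : 'I_n) p :
  path_edges (last x p) (rev (belast x p)) = rev (path_edges x p).
Proof.
elim: p x => // y q IHq x.
rewrite /= rev_cons -cats1 /path_edges pairmap_cat -/(path_edges _ _) IHq /=.
rewrite -/(path_edges y q) rev_cons -cats1; congr (_ ++ [:: _]).
suff -> : last (last y q) (rev (belast y q)) = y by rewrite setUC.
by case: q {IHq} => // w q; rewrite /= rev_cons last_rcons.
Qed.

Section Rainbow.
Variables (n : nat) (E : edge_set n).
Implicit Types (K : {set 'I_n}) (c : {set 'I_n} -> nat) (S : pred nat).

Lemma adj_sym : symmetric (adj E).
Proof. by move=> x y; rewrite /adj setUC. Qed.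

Lemma adj_neq x y : is_graph E -> adj E x y -> x != y.
Proof.
move=> /forall_inP gE /gE; apply: contraL => /eqP ->.
by rewrite setUid cards1.
Qed.

(** Walks rather than paths: concatenation then only requires disjoint palettes [S], not disjoint
    vertices. Repeated vertices are removed at the very end by [simple_subwalk], which keeps a
    subsequence of the edges. *)
Definition rwalk K c S x y := exists p,
  [&& path (adj E) x p, all (mem K) (x :: p), uniq (map c (path_edges x p)),
      all S (map c (path_edges x p)) & last x p == y].

Lemma rwalk_refl K c S x : x \in K -> rwalk K c S x x.
Proof. by move=> xK; exists [::]; rewrite /= xK eqxx. Qed.

Lemma rwalk_edge K c S x y : x \in K -> y \in K -> adj E x y ->
  S (c [set x; y]) -> rwalk K c S x y.
Proof. by move=> xK yK xy Sxy; exists [:: y]; rewrite /= xK yK xy Sxy eqxx. Qed.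

Lemma rwalk_sub K K' c (S S' : pred nat) x y :
  K \subset K' -> (forall i, S i -> S' i) -> rwalk K c S x y -> rwalk K' c S' x y.
Proof.
move=> /subsetP sK sS [p /and5P[pp pK pu pS pl]]; exists p; apply/and5P; split=> //.
  by apply/allP=> z /(allP pK)/sK.
by apply/allP=> i /(allP pS)/sS.
Qed.

Lemma rwalk_trans K c (S S1 S2 : pred nat) x y z :
  rwalk K c S1 x y -> rwalk K c S2 y z ->
  (forall i, S1 i -> ~~ S2 i) -> (forall i, S1 i || S2 i -> S i) ->
  rwalk K c S x z.
Proof.
move=> [p /and5P[pp pK pu pS /eqP pl]] [q /and5P[qp qK qu qS /eqP ql]] dS sS.
have qK' : all (mem K) q by case/andP: qK.
have pe : path_edges x (p ++ q) = path_edges x p ++ path_edges y q.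
  by rewrite /path_edges pairmap_cat pl.
exists (p ++ q); rewrite pe map_cat; apply/and5P; split.
- by rewrite cat_path pp pl qp.
- by rewrite -cat_cons all_cat pK qK'.
- rewrite cat_uniq pu qu andbT; apply/hasPn=> i /(allP qS) S2i.
  by apply/negP => /(allP pS)/dS; rewrite S2i.
- rewrite all_cat; apply/andP; split; apply/allP=> i.
    by move=> /(allP pS) S1i; rewrite sS ?S1i.
  by move=> /(allP qS) S2i; rewrite sS ?S2i ?orbT.
- by rewrite last_cat pl ql.
Qed.

Lemma rwalk_sym K c S x y : rwalk K c S x y -> rwalk K c S y x.
Proof.
move=> [p /and5P[pp pK pu pS /eqP pl]]; exists (rev (belast x p)); rewrite -pl.
apply/and5P; split; rewrite ?path_edges_rev ?map_rev ?rev_uniq ?all_rev //.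
- by rewrite rev_path (eq_path (e' := adj E)) // => u v; rewrite adj_sym.
- apply/allP=> z zin; apply: (allP pK).
  by rewrite lastI mem_rcons in_cons -mem_rev -in_cons.
- by case: p {pp pK pu pS pl} => //= a p; rewrite rev_cons last_rcons.
Qed.

Lemma rwalk_recolor K c c' S x y :
  {in K &, forall u v, c [set u; v] = c' [set u; v]} ->
  rwalk K c S x y -> rwalk K c' S x y.
Proof.
move=> cc [p /and5P[pp pK pu pS pl]]; exists p.
have <- : map c (path_edges x p) = map c' (path_edges x p).
  elim: p x pK {pp pu pS pl} => //= z p IHp w /and3P[wK zK pK].
  by rewrite cc // IHp //= zK.
exact/and5P.
Qed.

(** The walks stay inside [K], so edges that leave [K] remain free to be colored later. *)
Definition rainbow_on K k :=
  exists c, {in K &, forall x y, rwalk K c (fun i => i < k) x y}.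

Lemma rainbow_on_colorable k : 0 < k -> rainbow_on setT k -> rainbow_colorable E k.
Proof.
(* Colors from [k] on never occur on the walks; they are replaced by 0, which is a legal color as
   [k] is positive. *)
move=> k0 [c Hc]; exists (fun e => if c e < k then c e else 0); split.
  by move=> e _; case: ifP.
move=> x y; have [p /and5P[pp pK pu pS /eqP pl]] := Hc x y (in_setT _) (in_setT _).
have [p' [pp' up' lp' sp']] := simple_subwalk pp.
exists p'; split; last by rewrite lp'.
rewrite /rainbow_path pp' up' /=.
have smap : subseq (map c (path_edges x p')) (map c (path_edges x p)) by exact: map_subseq.
suff -> : map (fun e => if c e < k then c e else 0) (path_edges x p') = map c (path_edges x p').
  exact: subseq_uniq smap pu.
apply/eq_in_map => e /(map_f c)/(mem_subseq smap)/(allP pS) ->.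
by [].
Qed.

End Rainbow.

(** * Expansion and balls *)

Section Balls.
Variables (T : finType) (e : rel T).

Definition nbh (S : {set T}) := S :|: [set y | [exists x in S, e x y]].

Definition ball k x := iter k nbh [set x].

Lemma sub_nbh (S : {set T}) : S \subset nbh S. Proof. exact: subsetUl. Qed.

Lemma nbh_edge (S : {set T}) x y : x \in S -> e x y -> y \in nbh S.
Proof. by move=> xS xy; rewrite !inE; apply/orP; right; apply/exists_inP; exists x. Qed.

Lemma ball_subS k x : ball k x \subset ball k.+1 x.
Proof. exact: sub_nbh. Qed.

Lemma ball_sub j k x : j <= k -> ball j x \subset ball k x.
Proof.
move=> jk; rewrite -(subnK jk); elim: (k - j) => //= i IHi.
exact: subset_trans IHi (ball_subS _ _).
Qed.

Lemma ball_center k x : x \in ball k x.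
Proof. by apply: (subsetP (ball_sub x (leq0n k))); rewrite inE. Qed.

Lemma ball_path k x y : y \in ball k x ->
  exists p, [/\ path e x p, last x p = y & size p <= k].
Proof.
elim: k y => [|k IHk] y; first by rewrite inE => /eqP ->; exists [::].
rewrite inE => /orP[/IHk [p [pp pl ps]]|].
  by exists p; split=> //; apply: leqW.
rewrite inE => /exists_inP[z /IHk [p [pp pl ps]] zy].
by exists (rcons p y); rewrite rcons_path pp pl zy last_rcons size_rcons.
Qed.

Lemma path_ball x p : path e x p -> last x p \in ball (size p) x.
Proof.
elim/last_ind: p => [|p z IHp] //=; first by rewrite inE.
rewrite rcons_path last_rcons size_rcons => /andP[/IHp pin ez].
exact: nbh_edge pin ez.
Qed.

Lemma ball_sym k x y : symmetric e -> y \in ball k x -> x \in ball k y.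
Proof.
move=> se /ball_path [p [pp pl ps]].
have pr : path e y (rev (belast x p)).
  by rewrite -pl rev_path (eq_path (e' := e)) // => u v; rewrite se.
have /= := path_ball pr; rewrite size_rev size_belast.
have -> : last y (rev (belast x p)) = x.
  case: p {pp ps pr} pl => [|z p] /=; first by move->.
  by rewrite rev_cons last_rcons.
exact/subsetP/ball_sub.
Qed.

Lemma ball_trans j k x y z : y \in ball j x -> z \in ball k y -> z \in ball (j + k) x.
Proof.
move=> /ball_path [p [pp <- ps]] /ball_path [q [pq <- qs]].
rewrite -last_cat; apply/(subsetP (ball_sub x (leq_add ps qs))).
by rewrite -size_cat; apply: path_ball; rewrite cat_path pp.
Qed.

Lemma card_ball_gt k x :
  (forall j, j < k -> ball j x != ball j.+1 x) -> k < #|ball k x|.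
Proof.
elim: k => [|k IHk] H; first by rewrite cards1.
apply: leq_ltn_trans (IHk _) _; first by move=> j jk; apply: H; apply: ltnW.
by apply: proper_card; rewrite properEneq H // ball_subS.
Qed.

End Balls.

Section Cut.
Variables (n : nat) (E : edge_set n).
Implicit Types (A B X : {set 'I_n}).

(** Ordered pairs: an edge inside both [A] and [B] counts twice, while for [edge_cut], where the
    sets are disjoint, each edge counts once. *)
Definition cross_pairs A B :=
  [set p : 'I_n * 'I_n | [&& p.1 \in A, p.2 \in B & adj E p.1 p.2]].

Definition edges_between A B := #|cross_pairs A B|.

Definition edge_cut X := edges_between X (~: X).

Lemma edges_betweenE A B :
  edges_between A B = \sum_(x in A) #|[set y in B | adj E x y]|.
Proof.
rewrite /edges_between -sum1_card (eq_bigl (fun p : 'I_n * 'I_n =>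
  (p.1 \in A) && (p.2 \in [set y in B | adj E p.1 y]))); last first.
  by move=> p; rewrite !inE.
rewrite -(pair_big_dep (mem A) (fun x y => y \in [set y in B | adj E x y])
  (fun _ _ => 1)) /=.
by apply: eq_bigr => x _; rewrite sum1_card.
Qed.

Lemma edges_between_sym A B : edges_between A B = edges_between B A.
Proof.
have inj : injective (fun p : 'I_n * 'I_n => (p.2, p.1)) by move=> [a b] [c d] [-> ->].
rewrite /edges_between -(card_imset _ inj); apply: eq_card => -[x y].
apply/imsetP/idP.
  move=> [[u v]]; rewrite !inE /= => /and3P[uA vB uv] [-> ->].
  by rewrite uA vB adj_sym.
rewrite !inE /= => /and3P[xB yA xy]; exists (y, x) => //.
by rewrite !inE /= xB yA adj_sym.
Qed.

Lemma cutC X : edge_cut (~: X) = edge_cut X.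
Proof. by rewrite /edge_cut edges_between_sym setCK. Qed.

Lemma edges_betweenU A B1 B2 : edges_between A (B1 :|: B2) <=
  edges_between A B1 + edges_between A B2.
Proof.
rewrite -cardsUI; apply: leq_trans (leq_addr _ _); apply: subset_leq_card.
by apply/subsetP=> p; rewrite !inE => /and3P[-> /orP[] -> ->]; rewrite ?orbT.
Qed.

Variable (r : nat).
Hypothesis maxdeg : forall x, #|[set y | adj E x y]| <= r.

Lemma edges_between_leql A B : edges_between A B <= r * #|A|.
Proof.
rewrite edges_betweenE mulnC -sum_nat_const; apply: leq_sum => x _.
apply: leq_trans (maxdeg x); apply: subset_leq_card.
by apply/subsetP=> y; rewrite !inE => /andP[].
Qed.

Lemma edges_between_leqr A B : edges_between A B <= r * #|B|.
Proof. by rewrite edges_between_sym edges_between_leql. Qed.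

Lemma cut_nbh X : edge_cut X <= r * (#|nbh (adj E) X| - #|X|).
Proof.
have -> : #|nbh (adj E) X| - #|X| = #|nbh (adj E) X :\: X|.
  by rewrite cardsD (setIidPr (sub_nbh _ _)).
apply: leq_trans (edges_between_leqr X _); apply: subset_leq_card.
apply/subsetP=> -[x y]; rewrite !inE /= => /and3P[xX yX xy].
by rewrite xX yX xy andbT /=; apply/orP; right; apply/exists_inP; exists x.
Qed.

Variable (t : nat).
Hypothesis t_gt0 : 0 < t.
Hypothesis expands : forall X, 0 < #|X| -> 2 * #|X| <= n -> 2 * (#|X| %/ t).+1 <= edge_cut X.

Lemma cut_lower X : 0 < #|X| -> 2 * #|X| <= n -> 2 * #|X| <= t * edge_cut X.
Proof.
move=> X0 Xn; have := expands X0 Xn; have := ltn_ceil #|X| t_gt0; nia.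
Qed.

(** This is where the successor in the expansion hypothesis counts: the quotient by [t] may vanish.
    Sets of more than half of the vertices are replaced by their complements. *)
Lemma cut_ge2 X : 0 < #|X| < n -> 2 <= edge_cut X.
Proof.
move=> /andP[X0 Xn]; have [le|gt] := leqP (2 * #|X|) n.
  by apply: leq_trans (expands X0 le); rewrite mulnS leq_addr.
have cX := cardsC X; rewrite card_ord in cX.
rewrite -cutC; apply: leq_trans (expands _ _); first by rewrite mulnS leq_addr.
  by lia.
by lia.
Qed.

(* As long as it fills at most half of the graph, each further step adds to the ball at least
   2 / (r t) of the size of the initial one. *)
Lemma ball_double k x :
  (2 * #|ball (adj E) (k + r * t) x| <= n) ->
  2 * #|ball (adj E) k x| <= #|ball (adj E) (k + r * t) x|.
Proof.
pose b j := #|ball (adj E) j x| => H.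
have b0 j : 0 < b j by apply/card_gt0P; exists x; apply: ball_center.
have r0 : 0 < r.
  case: (posnP r) => // r0; move: (cut_lower (b0 k)) (cut_nbh (ball (adj E) k x)).
  rewrite r0 mul0n addn0 in H *; rewrite -/(b k) mul0n; have := b0 k.
  by rewrite -/(b k) in H *; nia.
have step j : j <= r * t -> 2 * b (k + j) <= n -> (r * t + 2 * j) * b k <= r * t * b (k + j).
  elim: j => [|j IHj] jr bn; first by rewrite addn0 muln0 addn0.
  have mon : b (k + j) <= b (k + j.+1) by rewrite addnS; apply/subset_leq_card/ball_subS.
  have mon0 : b k <= b (k + j) by apply/subset_leq_card/ball_sub/leq_addr.
  have le1 : 2 * b (k + j) <= n by lia.
  have := IHj (ltnW jr) le1.
  have := cut_lower (b0 (k + j)) le1.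
  have := cut_nbh (ball (adj E) (k + j) x).
  rewrite (_ : nbh _ _ = ball (adj E) (k + j.+1) x); last by rewrite addnS.
  rewrite -/(b (k + j)) -/(b (k + j.+1)).
  move: (edge_cut _) => C; nia.
have := step (r * t) (leqnn _) H; rewrite -/(b k) -/(b _).
have : 0 < r * t by rewrite muln_gt0 r0.
nia.
Qed.

Definition half_radius := r * t * (trunc_log 2 n).+1.

Lemma ball_half x : n < 2 * #|ball (adj E) half_radius x|.
Proof.
pose b j := #|ball (adj E) j x|.
rewrite ltnNge; apply/negP => H.
have step i : i <= (trunc_log 2 n).+1 -> 2 ^ i <= b (r * t * i).
  elim: i => [|i IHi] ile.
    by rewrite muln0 expn0; apply/card_gt0P; exists x; apply: ball_center.
  rewrite expnS mulnS addnC; apply: leq_trans (ball_double _).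
    by rewrite leq_mul2l IHi // ltnW.
  apply: leq_trans H; rewrite leq_mul2l /=; apply/subset_leq_card/ball_sub.
  by rewrite addnC -mulnS leq_mul2l ile orbT.
have big : 2 ^ (trunc_log 2 n).+1 <= #|ball (adj E) half_radius x| := step _ (leqnn _).
move: big H; move: #|_| => N big H.
have := leq_trans (trunc_log_ltn n (isT : 1 < 2)) big; lia.
Qed.

Lemma ball_full x : ball (adj E) (half_radius + half_radius) x = setT.
Proof.
apply/setP=> y; rewrite inE.
suff /set0Pn[z /setIP[zx zy]] : ball (adj E) half_radius x :&: ball (adj E) half_radius y != set0.
  by apply: ball_trans zx (ball_sym (@adj_sym _ E) zy).
have := ball_half x; have := ball_half y.
move: (ball _ _ x) (ball _ _ y) => A B hB hA; rewrite -card_gt0.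
have le : #|A :|: B| <= n by rewrite -[leqRHS]card_ord max_card.
have := cardsUI A B; lia.
Qed.

(** [d] is the distance to [v], at most twice the radius at which balls exceed half of the graph.
    The fixed point at the root makes [par] total, so that [fconnect par] is the ancestor
    relation. *)
Lemma bfs_tree (v : 'I_n) : exists (d : 'I_n -> nat) (par : 'I_n -> 'I_n),
  [/\ d v = 0, par v = v,
      forall u, u != v -> adj E u (par u) /\ d u = (d (par u)).+1 &
      forall u, d u <= half_radius + half_radius].
Proof.
set D := half_radius + half_radius.
have ex u : exists k, u \in ball (adj E) k v by exists D; rewrite ball_full inE.
pose d u := ex_minn (ex u).
have dP u : u \in ball (adj E) (d u) v by rewrite /d; case: ex_minnP.
have dmin u k : u \in ball (adj E) k v -> d u <= k by rewrite /d; case: ex_minnP => m _; apply.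
have dv : d v = 0 by apply/eqP; rewrite -leqn0 dmin // inE.
pose par u := if u == v then v else odflt u [pick w | adj E u w && (d u == (d w).+1)].
exists d, par; split=> //; first by rewrite /par eqxx.
- move=> u uv; rewrite /par (negPf uv).
  case: pickP => [w /andP[uw /eqP] //|/= H]; exfalso.
  case du: (d u) (dP u) => [|k].
    by rewrite inE (negPf uv).
  rewrite inE => /orP[/dmin|]; first by rewrite du ltnn.
  rewrite inE => /exists_inP[w wk wu].
  have := H w; rewrite adj_sym wu du eqSS /= eqn_leq (dmin _ _ wk) andbT => /negbT.
  rewrite -ltnNge => lt; have : d u <= (d w).+1 by apply: dmin; exact: nbh_edge (dP w) wu.
  by rewrite du; lia.
- by move=> u; apply: dmin; rewrite ball_full inE.
Qed.

End Cut.

(** * The core *)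

Section RootedTree.
Variables (T : finType) (v : T) (par : T -> T) (d : T -> nat).
Hypothesis dv : d v = 0.
Hypothesis parv : par v = v.
Hypothesis dpar : forall u, u != v -> d u = (d (par u)).+1.

Lemma depth_eq0 u : d u = 0 -> u = v.
Proof. by move=> du; apply/eqP; apply: contraT => /dpar; rewrite du. Qed.

Lemma depth_iter i u : i <= d u -> d (iter i par u) = d u - i.
Proof.
elim: i => [|i IHi] ile; first by rewrite subn0.
have di := IHi (ltnW ile); have nv : iter i par u != v.
  by apply: contraTneq ile => iv; move: di; rewrite iv dv; lia.
by have := dpar nv; rewrite /= di; lia.
Qed.

Lemma iter_root i u : d u <= i -> iter i par u = v.
Proof.
move=> ui; rewrite -(subnK ui) iterD.
have -> : iter (d u) par u = v by apply: depth_eq0; rewrite depth_iter // subnn.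
by elim: (i - d u) => //= j ->.
Qed.

Lemma ancestorP u a :
  reflect (d a <= d u /\ iter (d u - d a) par u = a) (fconnect par u a).
Proof.
apply: (iffP idP) => [/iter_findex|[_ <-]]; last exact: fconnect_iter.
move: (findex _ _ _) => k ka; have [ku|uk] := leqP k (d u).
  have da : d a = d u - k by rewrite -ka depth_iter.
  by split; rewrite da ?leq_subr // subKn.
by rewrite -ka (iter_root (ltnW uk)) dv subn0 iter_root.
Qed.

Lemma ancestor_depth u a : fconnect par u a -> d a <= d u.
Proof. by case/ancestorP. Qed.

Lemma ancestor_root u : fconnect par u v.
Proof. by apply/ancestorP; rewrite dv subn0 iter_root. Qed.

Lemma ancestor_chain u a b :
  fconnect par u a -> fconnect par u b -> d b <= d a -> fconnect par a b.
Proof.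
move=> /ancestorP[da ia] /ancestorP[db ib] ba; apply/ancestorP; split=> //.
by rewrite -[X in iter _ _ X]ia -iterD -[RHS]ib; congr (iter _ _ _); lia.
Qed.

Lemma ancestor_anti a b : fconnect par a b -> fconnect par b a -> a = b.
Proof.
move=> /ancestorP[ba iab] /ancestorP[ab _].
by rewrite -iab (_ : d a - d b = 0); last lia.
Qed.

Lemma ancestor_par u a : u != a -> fconnect par u a -> fconnect par (par u) a.
Proof.
move=> ua /iter_findex; case: (findex _ _ _) => [|k]; first by move/eqP; rewrite (negPf ua).
by rewrite iterSr => <-; apply: fconnect_iter.
Qed.

End RootedTree.

Section Core.
Variables (n : nat) (E : edge_set n).
Variables (v : 'I_n) (par : 'I_n -> 'I_n) (d : 'I_n -> nat) (D : nat).
Hypothesis dv : d v = 0.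
Hypothesis parv : par v = v.
Hypothesis dpar : forall u, u != v -> d u = (d (par u)).+1.
Hypothesis adjpar : forall u, u != v -> adj E u (par u).
Hypothesis dD : forall u, d u <= D.

(** The depth of the lower end strictly decreases along an ascent, so the colors are distinct. The
    range is open at [d a], hence consecutive ascents have disjoint palettes; [off] is the shift of
    the class of tree edges. *)
Lemma ascend (K : {set 'I_n}) (c : {set 'I_n} -> nat) off u a :
  fconnect par u a ->
  (forall w, fconnect par u w -> d a <= d w -> w \in K) ->
  (forall w, fconnect par u w -> d a < d w -> c [set w; par w] = off + d w) ->
  rwalk E K c (fun i => off + d a < i <= off + d u) u a.
Proof.
move=> /(ancestorP dv parv dpar)[da]; move kE: (d u - d a) => k ia HK Hc.
have {da kE} kE : k <= d u /\ d a = d u - k by lia.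
elim: k a kE ia HK Hc => [|k IHk] a [kd da] ia HK Hc.
  by rewrite -ia; apply: rwalk_refl; apply: HK => //; rewrite -ia.
set w := iter k par u; have uw : fconnect par u w by apply: fconnect_iter.
have dw : d w = d u - k by rewrite /w (depth_iter dv dpar) // ltnW.
have wv : w != v by apply: contraTneq kd => wv; move: dw; rewrite wv dv; lia.
have wa : par w = a by rewrite -ia.
apply: (@rwalk_trans _ _ _ _ _ (fun i => off + d w < i <= off + d u)
  (fun i => i == off + d w) u w a).
- apply: IHk => //; first by split; lia.
  + by move=> z uz dz; apply: HK => //; lia.
  + by move=> z uz dz; apply: Hc => //; lia.
- apply: rwalk_edge; first by apply: HK => //; lia.
  + by apply: HK => //; rewrite -ia fconnect_iter.
  + by rewrite -wa adjpar.
  + by rewrite -[in X in [set _; X]]wa Hc //; lia.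
- by move=> i; lia.
- by move=> i; lia.
Qed.

Variable c : 'I_n.
Hypothesis cv : c != v.

Definition branch := [set u | fconnect par u c].
Definition spine := [set u | fconnect par c u].
Definition exposed :=
  [set a | [exists b, adj E a b && ((a \in branch) != (b \in branch))]].
(** The ascent from an exposed vertex is stopped at the border of the branch. From inside, it ends
    at [c]; the rest of the way to the root belongs to the core anyway, by [spine_core]. *)
Definition core :=
  [set u | [exists a in exposed, ((u \in branch) == (a \in branch)) && fconnect par a u]].

(* An edge of the tree gets the depth of its lower end, shifted by 0, D + 1 or 2 (D + 1) inside the
   branch, on the path from c to the root and elsewhere; all other edges share
   the last color. *)
Definition core_color (e : {set 'I_n}) :=
  if [pick u | (u != v) && (e == [set u; par u])] is Some u then
    (if u \in branch :\ c then 0 else if u \in spine then D.+1 else 2 * D.+1) + d u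
  else 3 * D.+1.

Lemma par_neq u : u != v -> par u != u.
Proof. by move=> /dpar; apply: contra_eq_neq => ->; lia. Qed.

Lemma core_colorE u : u != v -> core_color [set u; par u] =
  (if u \in branch :\ c then 0 else if u \in spine then D.+1 else 2 * D.+1) + d u.
Proof.
move=> uv; rewrite /core_color; case: pickP => [w /andP[wv /eqP uw]|/(_ u)]; last first.
  by rewrite uv eqxx.
have [-> //|wu] := eqVneq w u; exfalso.
have : w \in [set u; par u] by rewrite uw !inE eqxx.
rewrite !inE (negPf wu) /= => /eqP wpu.
have : u \in [set w; par w] by rewrite -uw !inE eqxx.
rewrite !inE eq_sym (negPf wu) /= => /eqP upw.
by have := dpar uv; have := dpar wv; rewrite -wpu -upw; lia.
Qed.

Lemma branchN u : u \notin branch -> par u \notin branch.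
Proof. by apply: contra; rewrite !inE; apply: connect_trans; apply: fconnect1. Qed.

Lemma branch_par u : u \in branch -> u != c -> par u \in branch.
Proof. by rewrite !inE => uc ne; apply: ancestor_par. Qed.

Lemma branch_down u w : w \in branch -> fconnect par u w -> u \in branch.
Proof. by rewrite !inE => wc uw; apply: connect_trans uw wc. Qed.

Lemma parc_branchN : par c \notin branch.
Proof.
rewrite inE; apply/negP => /(ancestor_depth dv parv dpar).
by have := dpar cv; lia.
Qed.

Lemma branch_spine u : u \in branch -> u \in spine -> u = c.
Proof. by rewrite !inE => uc cu; apply: (ancestor_anti dv parv dpar). Qed.

(** The edge from [c] to its parent is the only tree edge between the two sides, so all other
    crossing edges have the last color. *)
Lemma core_color_cross a b : a \in branch -> b \notin branch ->
  (a != c) || (b != par c) -> core_color [set a; b] = 3 * D.+1.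
Proof.
move=> aB bB ne; rewrite /core_color; case: pickP => // u /andP[uv /eqP eu]; exfalso.
have ab : a != b by apply: contraNneq bB => <-.
have : u \in [set a; b] by rewrite eu !inE eqxx.
have : par u \in [set a; b] by rewrite eu !inE eqxx orbT.
rewrite !inE => /orP[]/eqP pu /orP[]/eqP uE.
- by have := par_neq uv; rewrite pu uE eqxx.
- by have := branchN bB; rewrite -uE pu aB.
- move: ne; rewrite -pu uE; have [->|ac _] := eqVneq a c; first by rewrite eqxx.
  by move: bB; rewrite -pu uE (branch_par aB ac).
- by have := par_neq uv; rewrite pu uE eqxx.
Qed.

Lemma exposed_core a : a \in exposed -> a \in core.
Proof. by move=> ea; rewrite inE; apply/exists_inP; exists a; rewrite // eqxx connect0. Qed.

Lemma core_up u w : u \in core -> fconnect par u w ->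
  (u \in branch) = (w \in branch) -> w \in core.
Proof.
rewrite [u \in core]inE => /exists_inP[a ea /andP[/eqP ua au]] uw e.
rewrite inE; apply/exists_inP; exists a; rewrite // -e ua eqxx /=.
exact: connect_trans au uw.
Qed.

Lemma crossing_exposed a b : adj E a b -> a \in branch -> b \notin branch ->
  (a \in exposed) && (b \in exposed).
Proof.
move=> ab aB bB; rewrite [a \in _]inE [b \in _]inE; apply/andP; split; apply/existsP.
  by exists b; rewrite ab aB (negPf bB).
by exists a; rewrite adj_sym ab aB (negPf bB).
Qed.

Lemma c_branch : c \in branch. Proof. by rewrite inE connect0. Qed.

Lemma c_crossing : (c \in exposed) && (par c \in exposed).
Proof. exact: crossing_exposed (adjpar cv) c_branch parc_branchN. Qed.

Lemma notbranch_up u w : u \notin branch -> fconnect par u w -> w \notin branch.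
Proof. by move=> uB uw; apply: contra uB => wB; apply: branch_down wB uw. Qed.

Lemma spine_core u : u \in spine -> u \in core.
Proof.
have /andP[ec epc] := c_crossing.
have [-> _|uc] := eqVneq u c; first exact: exposed_core.
rewrite inE => cu; have pu : fconnect par (par c) u by apply: ancestor_par; rewrite // eq_sym.
apply: (core_up (exposed_core epc) pu).
by rewrite (negPf parc_branchN) (negPf (notbranch_up parc_branchN pu)).
Qed.

Lemma walk_branch u a : u \in core -> a \in branch -> fconnect par u a ->
  rwalk E core core_color (fun i => d a < i <= d u) u a.
Proof.
move=> uK aB ua; have down w : fconnect par u w -> d a <= d w -> w \in branch.
  move=> uw dw; apply: (branch_down aB).
  exact: (ancestor_chain dv parv dpar uw ua dw).
have ca : d c <= d a by move: aB; rewrite inE => /(ancestor_depth dv parv dpar).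
apply: (@ascend _ _ 0) => // w uw dw.
  by apply: (core_up uK uw); rewrite (down _ uw dw) (branch_down aB ua).
have wv : w != v by apply: contraTneq dw => ->; rewrite dv.
rewrite core_colorE // in_setD1 (down _ uw (ltnW dw)) andbT.
by have -> : w != c by apply: contraTneq dw => ->; rewrite -leqNgt.
Qed.

Lemma walk_outside u b : u \in core -> u \notin branch -> fconnect par u b ->
  (forall w, fconnect par u w -> d b < d w -> w \notin spine) ->
  rwalk E core core_color (fun i => 2 * D.+1 + d b < i <= 2 * D.+1 + d u) u b.
Proof.
move=> uK uB ub Hs; apply: ascend => // w uw dw.
  by apply: (core_up uK uw); rewrite (negPf uB) (negPf (notbranch_up uB uw)).
have wv : w != v by apply: contraTneq dw => ->; rewrite dv.
rewrite core_colorE // in_setD1 (negPf (notbranch_up uB uw)) andbF.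
by rewrite (negPf (Hs _ uw dw)).
Qed.

Lemma walk_spine z z' : z \in spine -> z' \in spine ->
  rwalk E core core_color (fun i => D.+1 < i <= D.+1 + D) z z'.
Proof.
wlog dz : z z' / d z' <= d z => [H|] zS z'S.
  by have [/H|/ltnW/H h] := leqP (d z') (d z); [apply | apply/rwalk_sym/h].
have zz : fconnect par z z'.
  by move: zS z'S; rewrite !inE => cz cz'; apply: (ancestor_chain dv parv dpar cz cz').
have up w : fconnect par z w -> w \in spine.
  by move=> zw; move: zS; rewrite !inE => cz; apply: connect_trans zw.
apply: (@rwalk_sub _ _ core _ _ (fun i => D.+1 + d z' < i <= D.+1 + d z)) => //.
  by move=> i; have := dD z; lia.
apply: ascend => // w zw dw; first exact: spine_core (up _ zw).
have wv : w != v by apply: contraTneq dw => ->; rewrite dv.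
rewrite core_colorE // (up _ zw) ifF //; apply/negP => /setD1P[wc wB].
by move: wc; rewrite (branch_spine wB (up _ zw)) eqxx.
Qed.

Lemma walk_to_spine u : u \in core -> u \notin branch -> exists2 z, z \in spine &
  rwalk E core core_color (fun i => 2 * D.+1 < i <= 2 * D.+1 + d u) u z.
Proof.
move=> uK uB; pose P z := fconnect par u z && (z \in spine).
have Pv : P v by rewrite /P inE !(ancestor_root dv parv dpar).
(* The deepest ancestor on the spine: below it, the ascent meets no spine edge and uses the third
   class of colors only. *)
case: (@arg_maxnP _ v P d Pv) => z /andP[uz zS] zmax; exists z => //.
apply: (@rwalk_sub _ _ core _ _ (fun i => 2 * D.+1 + d z < i <= 2 * D.+1 + d u)) => //.
  by move=> i; lia.
apply: walk_outside => // w uw dw; apply/negP => wS.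
by have := zmax w; rewrite /P uw wS => /(_ isT) /=; lia.
Qed.

(** The walk climbs to [c], follows the spine, and descends to [y], using one color class for each.
    Bounding the outer classes by [d x] and [d y] instead of [D] leaves the colors above these
    depths free. *)
Lemma walk_across x y : x \in core -> x \in branch -> y \in core -> y \notin branch ->
  rwalk E core core_color (fun i => [|| i <= d x, D.+1 < i <= D.+1 + D |
     2 * D.+1 < i <= 2 * D.+1 + d y]) x y.
Proof.
move=> xK xB yK yB; have [z zS yz] := walk_to_spine yK yB.
have xc : fconnect par x c by move: xB; rewrite inE.
have cS : c \in spine by rewrite inE connect0.
apply: (rwalk_trans (S := fun i => _) (walk_branch xK c_branch xc)
  (rwalk_trans (S := fun i => (D.+1 < i <= D.+1 + D) || (2 * D.+1 < i <= 2 * D.+1 + d y))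
    (walk_spine cS zS) (rwalk_sym yz) _ _)); move=> i; have := dD x; have := dD y; lia.
Qed.

(* If x and y lie on the same side and d x <= d y, then y descends to an exposed vertex, along
   colors above d y, and crosses; from there one reaches x by [walk_across], whose colors on the
   side of x are at most d x. *)
Lemma core_rainbow : rainbow_on E core (3 * D.+1).+1.
Proof.
exists core_color => x y.
have across a b : a \in core -> a \in branch -> b \in core -> b \notin branch ->
    rwalk E core core_color (fun i => i < (3 * D.+1).+1) a b.
  move=> aK aB bK bB; apply: rwalk_sub (walk_across aK aB bK bB) => // i.
  by have := dD a; have := dD b; lia.
wlog dxy : x y / d x <= d y => [H|] xK yK.
  have [/H|/ltnW/H h] := leqP (d x) (d y); first exact.
  exact/rwalk_sym/h.
have [xB|xB] := boolP (x \in branch); have [yB|yB] := boolP (y \in branch).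
- have [->|yc] := eqVneq y c.
    have xc : fconnect par x c by move: xB; rewrite inE.
    apply: rwalk_sub (walk_branch xK c_branch xc) => // i; have := dD x; lia.
  move: (yK); rewrite [y \in _]inE => /exists_inP[a ea /andP[/eqP ya ay]].
  have aB : a \in branch by rewrite -ya.
  have ac : a != c.
    apply: contraNneq yc => ac; apply/eqP/(branch_spine yB).
    by rewrite inE -ac.
  move: (ea); rewrite [a \in _]inE => /existsP[b /andP[ab]]; rewrite aB.
  move=> bB'; have {bB'}bB : b \notin branch by move: bB'; case: (b \in branch).
  have /andP[_ eb] := crossing_exposed ab aB bB.
  have aK := exposed_core ea; have bK := exposed_core eb.
  have w1 := rwalk_sym (walk_branch aK yB ay).
  have w2 : rwalk E core core_color (pred1 (3 * D.+1)) a b.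
    by apply: rwalk_edge => //=; rewrite core_color_cross ?ac.
  have w3 := rwalk_sym (walk_across xK xB bK bB).
  have w23 : rwalk E core core_color (fun i => (i == 3 * D.+1) ||
      [|| i <= d x, D.+1 < i <= D.+1 + D | 2 * D.+1 < i <= 2 * D.+1 + d b]) a x.
    apply: (rwalk_trans w2 w3) => [i /eqP ->|//].
    by have := dD x; have := dD b; clear => ? ?; apply/negP => /or3P[]; lia.
  have := dD a; have := dD x; have := dD b => dbD dxD daD.
  apply/rwalk_sym/(rwalk_trans w1 w23) => i; clear -dbD dxD daD dxy.
    by move=> /andP[lo hi]; apply/negP => /or4P[]; lia.
  by case/orP => [/andP[lo hi]|/or4P[]]; lia.
- exact: across.
- exact/rwalk_sym/across.
(* A descent from a spine vertex could use spine edges, whose colors [walk_across] needs as well;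
   but here the spine itself leads from the ascent of [x] to [y]. *)
- have [yS|yS] := boolP (y \in spine).
    have [z zS xz] := walk_to_spine xK xB.
    apply: (rwalk_trans xz (walk_spine zS yS)) => i; have := dD x; lia.
  move: (yK); rewrite [y \in _]inE => /exists_inP[b eb /andP[/eqP yb by_]].
  have bB : b \notin branch by rewrite -yb.
  have bS : b \notin spine.
    by apply: contra yS; rewrite !inE => cb; apply: connect_trans by_.
  move: (eb); rewrite [b \in _]inE => /existsP[a /andP[ba]]; rewrite (negPf bB) => aB.
  have {}aB : a \in branch by move: aB; case: (a \in branch).
  have /andP[ea _] := crossing_exposed (etrans (adj_sym _ _ _) ba) aB bB.
  have aK := exposed_core ea; have bK := exposed_core eb.
  have w1 : rwalk E core core_color (fun i => 2 * D.+1 + d y < i <= 2 * D.+1 + d b) y b.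
    apply: rwalk_sym (walk_outside bK bB by_ _) => w bw dw.
    apply: contra yS; rewrite !inE => cw; apply: connect_trans cw _.
    exact: (ancestor_chain dv parv dpar bw by_ (ltnW dw)).
  have w2 : rwalk E core core_color (pred1 (3 * D.+1)) b a.
    apply: rwalk_edge => //=; rewrite setUC core_color_cross //.
    by apply/orP; right; apply: contraNneq bS => ->; rewrite inE fconnect1.
  have w3 := walk_across aK aB xK xB.
  have w23 : rwalk E core core_color (fun i => (i == 3 * D.+1) ||
      [|| i <= d a, D.+1 < i <= D.+1 + D | 2 * D.+1 < i <= 2 * D.+1 + d x]) b x.
    apply: (rwalk_trans w2 w3) => [i /eqP ->|//].
    by have := dD x; have := dD a; clear => ? ?; apply/negP => /or3P[]; lia.
  have := dD a; have := dD x; have := dD b => dbD dxD daD.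
  apply/rwalk_sym/(rwalk_trans w1 w23) => i; clear -dbD dxD daD dxy.
    by move=> /andP[lo hi]; apply/negP => /or4P[]; lia.
  by case/orP => [/andP[lo hi]|/or4P[]]; lia.
Qed.

Lemma cut_branch_core r : (forall x, #|[set y | adj E x y]| <= r) ->
  edge_cut E branch <= r * #|core|.
Proof.
move=> maxdeg; apply: leq_trans (_ : edges_between E exposed (~: branch) <= _).
  apply/subset_leq_card/subsetP => -[a b].
  rewrite [_ \in cross_pairs _ _ _]in_set /= => /and3P[aB bB ab].
  rewrite [_ \in cross_pairs _ _ _]in_set /= bB ab !andbT.
  move: bB; rewrite in_setC => bB.
  by have /andP[] := crossing_exposed ab aB bB.
apply: leq_trans (edges_between_leql maxdeg _ _) _; rewrite leq_mul2l.
apply/orP; right; apply/subset_leq_card/subsetP => a; exact: exposed_core.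
Qed.

End Core.

Lemma card_bigcup_leq (I T : finType) (P : pred I) (F : I -> {set T}) :
  #|\bigcup_(i | P i) F i| <= \sum_(i | P i) #|F i|.
Proof.
elim/big_rec2: _ => [|i x y _ le]; first by rewrite cards0.
by apply: leq_trans (leq_card_setU _ _) _; rewrite leq_add2l.
Qed.

(** Take a smallest branch with at least m = n %/ (2 r) vertices. The branches at the children of
    its top have fewer than m vertices, and there are at most r of them, so it has at most 1 + r (m
    - 1) vertices. *)
Lemma balanced_branch n (E : edge_set n) r (v : 'I_n) par d :
  (forall x, #|[set y | adj E x y]| <= r) ->
  d v = 0 -> par v = v -> (forall u, u != v -> d u = (d (par u)).+1) ->
  (forall u, u != v -> adj E u (par u)) -> 0 < r -> 2 * r <= n ->
  exists2 c, c != v & n %/ (2 * r) <= #|branch par c| /\ 2 * #|branch par c| <= n.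
Proof.
move=> maxdeg dv parv dpar adjpar r0 rn.
set m := n %/ (2 * r).
have m0 : 0 < m by rewrite /m divn_gt0 // muln_gt0.
have mn : m * (2 * r) <= n by apply: leq_divM.
have bv : branch par v = setT.
  by apply/setP=> u; rewrite !inE (ancestor_root dv parv dpar).
have Pv : m <= #|branch par v| by rewrite bv cardsT card_ord; nia.
case: (@arg_minnP _ v (fun u => m <= #|branch par u|) (fun u => #|branch par u|) Pv).
move=> c mc cmin.
pose children := [set w | (w != c) && (par w == c)].
have childv w : w \in children -> w != v.
  by rewrite inE => /andP[wc /eqP wp]; apply: contraNneq wc => wv; rewrite -wp wv parv.
have small w : w \in children -> #|branch par w| <= m.-1.
  move=> wch; have wv := childv w wch; move: wch; rewrite inE => /andP[wc /eqP wp].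
  rewrite -ltnS (prednK m0) ltnNge; apply/negP => /cmin; apply/negP; rewrite -ltnNge.
  apply: proper_card; apply/properP; split.
    apply/subsetP=> u; rewrite !inE => uw; apply: connect_trans uw _.
    by rewrite -wp fconnect1.
  exists c; first by rewrite inE connect0.
  rewrite inE; apply/negP => /(ancestor_depth dv parv dpar).
  by have := dpar _ wv; rewrite wp; lia.
have cover : branch par c \subset c |: \bigcup_(w in children) branch par w.
  apply/subsetP=> u; rewrite !inE => /iter_findex.
  move: (findex _ _ _) => k; elim: k u => [|k IHk] u; first by move=> /= ->; rewrite eqxx.
  rewrite iterSr => /IHk /orP[/eqP puc|/bigcupP[w wch]].
    have [//|uc /=] := eqVneq u c; apply/bigcupP; exists u.
      by rewrite inE uc puc eqxx.
    by rewrite inE connect0.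
  rewrite inE => puw; apply/orP; right; apply/bigcupP; exists w; rewrite // inE.
  exact: connect_trans (fconnect1 _ _) puw.
have le : #|branch par c| <= 1 + r * m.-1.
  apply: leq_trans (subset_leq_card cover) _.
  apply: leq_trans (leq_card_setU _ _) _; rewrite cards1 leq_add2l.
  apply: leq_trans (card_bigcup_leq _ _) _.
  apply: leq_trans (_ : \sum_(w in children) m.-1 <= _); first by apply: leq_sum.
  rewrite sum_nat_const leq_mul2r; apply/orP; right.
  apply: leq_trans (maxdeg c); apply/subset_leq_card/subsetP=> w wch.
  have wv := childv w wch; move: wch; rewrite !inE => /andP[wc /eqP wp].
  by rewrite adj_sym -wp adjpar.
have le2 : 2 * #|branch par c| <= n by nia.
exists c => //; apply: contraTneq le2 => ->; rewrite bv cardsT card_ord -ltnNge; nia.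
Qed.

(** With m = n %/ (2 r) >= 1 and C the cut of the branch, n <= 4 r m, 2 m <= t C and C <= r #|K|
    combine to the density of [K]. *)
Lemma rainbow_core n (E : edge_set n) r t :
  (forall x, #|[set y | adj E x y]| <= r) -> 0 < t ->
  (forall X : {set 'I_n}, 0 < #|X| -> 2 * #|X| <= n -> 2 * (#|X| %/ t).+1 <= edge_cut E X) ->
  0 < r -> 2 * r <= n ->
  exists2 K : {set 'I_n}, n <= 2 * r * r * t * #|K| &
    rainbow_on E K (3 * (half_radius n r t + half_radius n r t).+1).+1.
Proof.
move=> maxdeg t0 expands r0 rn.
have n0 : 0 < n by nia.
have [d [par [dv parv adjpar dD]]] := bfs_tree maxdeg t0 expands (Ordinal n0).
have dpar u : u != Ordinal n0 -> d u = (d (par u)).+1 by move=> /adjpar[].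
have adjp u : u != Ordinal n0 -> adj E u (par u) by move=> /adjpar[].
have [c cv [lo hi]] := balanced_branch maxdeg dv parv dpar adjp r0 rn.
exists (core E par c); last exact: (core_rainbow dv parv dpar adjp dD cv).
have b0 : 0 < #|branch par c| by apply/card_gt0P; exists c; rewrite inE connect0.
have := cut_branch_core par c maxdeg.
have := cut_lower t0 expands b0 hi.
have : n < (n %/ (2 * r)).+1 * (2 * r) by rewrite ltn_ceil // muln_gt0.
have : 0 < n %/ (2 * r) by rewrite divn_gt0 // muln_gt0.
move: (n %/ _) lo (edge_cut _ _) => m lo C m0 nm C1 C2.
have n1 : n <= 4 * r * m by nia.
have mC : 2 * m <= t * C by apply: leq_trans C1; rewrite leq_mul2l.
have n2 : 4 * r * m <= 2 * r * (t * C).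
  by rewrite (_ : 4 * r * m = 2 * r * (2 * m)) ?leq_mul2l ?mC ?orbT //; lia.
apply: (leq_trans n1 (leq_trans n2 _)).
by rewrite -!mulnA !leq_mul2l /= mulnCA leq_mul2l C2 !orbT.
Qed.

(** * Ears *)

Lemma sum_disjoint_leq (I T : finType) (A : {set I}) (B : {set T}) (F : I -> {set T})
    (g : T -> nat) :
  {in A &, forall i j x, x \in F i -> x \in F j -> i = j} ->
  {in A, forall i, F i \subset B} ->
  \sum_(i in A) \sum_(x in F i) g x <= \sum_(x in B) g x.
Proof.
move=> dis sub; rewrite (exchange_big_dep (mem B)) /=; last first.
  by move=> i x iA xF; apply: (subsetP (sub i iA)).
apply: leq_sum => x xB; rewrite sum_nat_const -{2}[g x]mul1n leq_mul2r.
apply/orP; right; apply/card_le1_eqP => i j; rewrite !unfold_in.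
by move=> /andP[iA xi] /andP[jA xj]; rewrite (dis i j iA jA x xi xj).
Qed.

Section Ears.
Variables (n : nat) (E : edge_set n).
Implicit Types (K Z : {set 'I_n}).

(* Z is a disjoint union of ears: L and R are the two neighbors along the ear, and pos is the
   position on it, starting from 1 at the left end. *)
Definition ear_system l K Z (L R : 'I_n -> 'I_n) (pos : 'I_n -> nat) :=
  forall q, q \in Z ->
  [/\ q \notin K /\ 0 < pos q <= l, adj E q (L q) && adj E q (R q),
      L q \in K \/ [/\ L q \in Z, pos q = (pos (L q)).+1 & R (L q) = q],
      R q \in K \/ [/\ R q \in Z, pos (R q) = (pos q).+1 & L (R q) = q] &
      L q \in K -> R q \in K -> L q != R q].

Section EarColoring.
Variables (l k : nat) (K Z : {set 'I_n}) (L R : 'I_n -> 'I_n) (pos : 'I_n -> nat).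
Hypothesis ears : ear_system l K Z L R pos.
Variable c : {set 'I_n} -> nat.

(** An ear edge gets its index along the ear, from 0 at the left end, shifted by [k]. An inner edge
    is the right edge of one vertex and the left edge of the next, and both descriptions give the
    same index. *)
Definition ear_color (e : {set 'I_n}) :=
  if e \subset K then c e
  else if [pick q in Z | e == [set q; L q]] is Some q then k + (pos q).-1
  else if [pick q in Z | e == [set q; R q]] is Some q then k + pos q
  else 0.

Lemma ear_sub q x : q \in Z -> ([set q; x] \subset K) = false.
Proof. by case/ears=> -[qK _] _ _ _ _; rewrite subUset sub1set (negPf qK). Qed.

Lemma ear_colorL q : q \in Z -> ear_color [set q; L q] = k + (pos q).-1.
Proof.
move=> qZ; rewrite /ear_color ear_sub //.
case: pickP => [u /andP[uZ /eqP qu]|/(_ q)]; last by rewrite qZ eqxx.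
have [-> //|uq] := eqVneq u q; exfalso.
have : u \in [set q; L q] by rewrite qu !inE eqxx.
rewrite !inE (negPf uq) /= => /eqP uL.
have : q \in [set u; L u] by rewrite -qu !inE eqxx.
rewrite !inE eq_sym (negPf uq) /= => /eqP qL.
have [[qK _] _ qLK _ _] := ears qZ; have [[uK _] _ uLK _ _] := ears uZ.
case: qLK; rewrite -uL ?(negPf uK) // => -[_ pq _].
by case: uLK; rewrite -qL ?(negPf qK) // => -[_ pu _]; move: pq pu; lia.
Qed.

Lemma ear_colorR q : q \in Z -> ear_color [set q; R q] = k + pos q.
Proof.
move=> qZ; rewrite /ear_color ear_sub //.
have [[qK _] _ qLK qRK qLR] := ears qZ.
case: pickP => [u /andP[uZ /eqP qu]|_].
  have [[uK _] _ uLK _ _] := ears uZ.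
  have [uq|uq] := eqVneq u q.
    exfalso; have : L q \in [set q; R q] by rewrite qu uq !inE eqxx orbT.
    have Lq : L q != q by apply: contraNneq qK => Lq; case: qLK; rewrite Lq // => -[_]; lia.
    rewrite !inE (negPf Lq) /= => /eqP LR.
    have := qLR; rewrite LR eqxx; case: qRK => [-> /(_ isT isT) //|[RZ pR _] _].
    have [[RK _] _ _ _ _] := ears RZ.
    by case: qLK; rewrite LR ?(negPf RK) // => -[_ pL _]; move: pR pL; lia.
  have : u \in [set q; R q] by rewrite qu !inE eqxx.
  rewrite !inE (negPf uq) /= => /eqP uR.
  by case: qRK; rewrite -uR ?(negPf uK) // => -[_ -> _].
case: pickP => [u /andP[uZ /eqP qu]|/(_ q)]; last by rewrite qZ eqxx.
have [-> //|uq] := eqVneq u q; exfalso.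
have : u \in [set q; R q] by rewrite qu !inE eqxx.
rewrite !inE (negPf uq) /= => /eqP uR.
have : q \in [set u; R u] by rewrite -qu !inE eqxx.
rewrite !inE eq_sym (negPf uq) /= => /eqP qR.
have [[uK _] _ _ uRK _] := ears uZ.
case: qRK; rewrite -uR ?(negPf uK) // => -[_ pq _].
by case: uRK; rewrite -qR ?(negPf qK) // => -[_ pu _]; move: pq pu; lia.
Qed.

Lemma ear_left q : q \in Z -> exists2 z, z \in K &
  rwalk E (K :|: Z) ear_color (fun i => k <= i < k + pos q) q z.
Proof.
elim: {q}(pos q) {-2}q (leqnn (pos q)) => [|m IHm] q pm qZ.
  by have [[_]] := ears qZ; case: (pos q) pm.
have [[qK pq] /andP[qL _] LK _ _] := ears qZ.
have qU : q \in K :|: Z by rewrite inE qZ orbT.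
have e1 : ear_color [set q; L q] = k + (pos q).-1 by apply: ear_colorL.
case: LK => [LK|[LZ pL _]].
  exists (L q) => //; apply: rwalk_edge => //; first by rewrite inE LK.
  by rewrite e1; lia.
have [||z zK w] := IHm (L q) => //; first by lia.
exists z => //.
have w1 : rwalk E (K :|: Z) ear_color (pred1 (k + (pos q).-1)) q (L q).
  by apply: rwalk_edge; rewrite //= ?e1 ?eqxx // inE LZ orbT.
by apply: (rwalk_trans w1 w) => i /=; lia.
Qed.

Lemma ear_right q : q \in Z -> exists2 z, z \in K &
  rwalk E (K :|: Z) ear_color (fun i => k + pos q <= i < k + l.+1) q z.
Proof.
elim: {q}(l - pos q) {-2}q (leqnn (l - pos q)) => [|m IHm] q pm qZ;
  have [[qK pq] /andP[_ qR] _ RK _] := ears qZ;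
  have qU : q \in K :|: Z by rewrite inE qZ orbT.
  case: RK => [RK|[RZ pR _]]; last first.
    by have [[_ pR'] _ _ _ _] := ears RZ; move: pm pR pR'; lia.
  exists (R q) => //; apply: rwalk_edge => //; first by rewrite inE RK.
  by rewrite ear_colorR //; lia.
have e1 : ear_color [set q; R q] = k + pos q by apply: ear_colorR.
case: RK => [RK|[RZ pR _]].
  exists (R q) => //; apply: rwalk_edge => //; first by rewrite inE RK.
  by rewrite e1; lia.
have [||z zK w] := IHm (R q) => //; first by lia.
exists z => //.
have w1 : rwalk E (K :|: Z) ear_color (pred1 (k + pos q)) q (R q).
  by apply: rwalk_edge; rewrite //= ?e1 ?eqxx // inE RZ orbT.
by apply: (rwalk_trans w1 w) => i /=; lia.
Qed.

Hypothesis rainbowK : {in K &, forall x y, rwalk E K c (fun i => i < k) x y}.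

(* Of two vertices on ears, the one at the smaller position leaves by the left end of its ear and
   the other one by the right end, so that the colors used are disjoint. *)
Lemma ear_rainbow_walk : {in K :|: Z &, forall x y,
  rwalk E (K :|: Z) ear_color (fun i => i < k + l.+1) x y}.
Proof.
have base x y : x \in K -> y \in K -> rwalk E (K :|: Z) ear_color (fun i => i < k) x y.
  move=> xK yK; apply: (@rwalk_sub _ _ K _ _ (fun i => i < k)) => //; first exact: subsetUl.
  apply: rwalk_recolor (rainbowK xK yK) => u w uK wK.
  by rewrite /ear_color subUset !sub1set uK wK.
have mixed x y : x \in Z -> y \in K -> rwalk E (K :|: Z) ear_color (fun i => i < k + l.+1) x y.
  move=> xZ yK; have [z zK w] := ear_left xZ.
  have [[_ px] _ _ _ _] := ears xZ.
  by apply: (rwalk_trans w (base _ _ zK yK)) => i; lia.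
move=> x y; rewrite !inE; case: (boolP (x \in K)) => [xK _|xK /= xZ].
  case: (boolP (y \in K)) => [yK _|yK /= yZ]; last exact/rwalk_sym/mixed.
  by apply: rwalk_sub (base _ _ xK yK) => // i; lia.
case: (boolP (y \in K)) => [yK _|yK /= yZ]; first exact: mixed.
wlog pxy : x y xK yK xZ yZ / pos x <= pos y => [H|].
  by have [/H|/ltnW/H h] := leqP (pos x) (pos y); [apply | apply/rwalk_sym/h].
have [z zK w] := ear_left xZ; have [z' zK' w'] := ear_right yZ.
have [[_ px] _ _ _ _] := ears xZ; have [[_ py] _ _ _ _] := ears yZ.
have w2 : rwalk E (K :|: Z) ear_color (fun i => (i < k) || (k + pos y <= i < k + l.+1)) z y.
  by apply: (rwalk_trans (base _ _ zK zK') (rwalk_sym w')) => i; lia.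
by apply: (rwalk_trans w w2) => i; lia.
Qed.

End EarColoring.

Lemma ear_rainbow l k K Z L R pos : ear_system l K Z L R pos ->
  rainbow_on E K k -> rainbow_on E (K :|: Z) (k + l.+1).
Proof.
by move=> ears [c Hc]; exists (ear_color k K Z L R pos c); apply: ear_rainbow_walk.
Qed.

Lemma ear_system_add l K Z L R pos a b y p :
  ear_system l K Z L R pos ->
  path (adj E) y p -> uniq (y :: p) -> size (y :: p) <= l ->
  {in y :: p, forall q, q \notin K :|: Z} ->
  a \in K -> b \in K -> adj E a y -> adj E (last y p) b ->
  (p = [::] -> a != b) ->
  exists L' R' pos', ear_system l K (Z :|: [set q in y :: p]) L' R' pos'.
Proof.
move=> ears pp up sp sN aK bK ay pb ab.
set s := y :: p in up sp sN *.
(* Putting [a] in front shifts the list by one, so this is the predecessor, and [a] for the first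
   vertex. In [R'] the default value [b] follows the last vertex. *)
pose L' q := if q \in s then nth a (a :: s) (index q s) else L q.
pose R' q := if q \in s then nth b s (index q s).+1 else R q.
pose pos' q := if q \in s then (index q s).+1 else pos q.
have ZN q : q \in Z -> q \notin s.
  by move=> qZ; apply/negP => /sN; rewrite inE qZ orbT.
have KN q : q \in K -> q \notin s.
  by move=> qK; apply/negP => /sN; rewrite inE qK.
exists L', R', pos' => q; rewrite in_setU in_set -/s; case: (boolP (q \in Z)) => [qZ _|_ /= qs].
  have qs := ZN q qZ; have [qp qa qL qR qLR] := ears q qZ.
  rewrite /L' /R' /pos' (negPf qs); split=> //.
    case: qL => [|[LZ pL RL]]; [by left | right].
    by rewrite (negPf (ZN _ LZ)) in_setU LZ.
  case: qR => [|[RZ pR LR]]; [by left | right].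
  by rewrite (negPf (ZN _ RZ)) in_setU RZ.
have is_ : index q s < size s by rewrite index_mem.
have qE z : nth z s (index q s) = q by apply: nth_index.
have qK : q \notin K by move: (sN q qs); rewrite inE negb_or => /andP[].
set i := index q s in is_ qE *.
have Lq : L' q = nth a (a :: s) i by rewrite /L' qs.
have Rq : R' q = nth b s i.+1 by rewrite /R' qs.
have pq : pos' q = i.+1 by rewrite /pos' qs.
clearbody i.
have RqK : i.+1 < size s -> R' q \in s by move=> lt; rewrite Rq mem_nth.
have LqK : 0 < i -> L' q \in s.
  by rewrite Lq; case: i is_ {qE Lq Rq pq RqK} => //= j js _; rewrite mem_nth // ltnW.
split.
- by split=> //; rewrite pq; apply: leq_trans sp.
- apply/andP; split.
    rewrite adj_sym Lq -(qE a); have pas : path (adj E) a s by rewrite /= ay.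
    exact: (pathP a pas).
  rewrite Rq -(qE b); have [lt|ge] := ltnP i.+1 (size s).
    have /(pathP b) /(_ i) := pp; rewrite -/s; apply; exact: lt.
  have iE : i.+1 = size s by apply/eqP; rewrite eqn_leq ge is_.
  rewrite (nth_default _ ge) (_ : i = (size s).-1); last by rewrite -iE.
  by rewrite nth_last.
- case: (posnP i) => [i0|i0]; [left | right]; first by rewrite Lq i0.
  have Ls := LqK i0.
  have iL : index (L' q) s = i.-1.
    rewrite Lq; case: i i0 is_ {qE Lq Rq pq RqK LqK Ls} => // j _ js.
    by rewrite -[nth _ _ _]/(nth a s j) index_uniq // ltnW.
  split; first by rewrite in_setU in_set Ls orbT.
    by rewrite pq /pos' Ls iL prednK.
  by rewrite /R' Ls iL prednK.
- case: (ltnP i.+1 (size s)) => [lt|ge]; [right | left]; last by rewrite Rq nth_default.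
  have Rs := RqK lt.
  have iR : index (R' q) s = i.+1 by rewrite Rq index_uniq.
  split; first by rewrite in_setU in_set Rs orbT.
    by rewrite pq /pos' Rs iR.
  by rewrite /L' Rs iR /= qE.
- move=> LK RK; have i0 : i = 0.
    by apply/eqP; rewrite -leqn0 leqNgt; apply/negP => /LqK; apply/negP/KN.
  have ge : size s <= i.+1.
    by rewrite leqNgt; apply/negP => /RqK; apply/negP/KN.
  rewrite Lq Rq (nth_default b ge) i0 /=; apply: ab.
  by move: ge; rewrite i0 /s /=; case: (p).
Qed.

Variables r t : nat.
Hypothesis maxdeg : forall x, #|[set y | adj E x y]| <= r.
Hypothesis t_gt0 : 0 < t.
Hypothesis expands : forall X : {set 'I_n},
  0 < #|X| -> 2 * #|X| <= n -> 2 * (#|X| %/ t).+1 <= edge_cut E X.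

(* Y is the set of uncovered vertices and Y1 the set of those attached to K.  If no ear can be
   added, the balls of radius W in Y around the points of Y1 are pairwise disjoint, and those away
   from Z have more than W elements: a ball B that stops growing is left by a single edge,
   contradicting [cut_ge2].  As Y1 has about [edge_cut E K] elements, they cannot all fit. *)
Lemma ear_extend W K Z L R pos :
  ear_system (2 * W).+1 K Z L R pos -> 0 < #|K| ->
  2 * #|~: K| <= W * edge_cut E K -> 2 * r * W * #|Z| < #|~: K| ->
  exists Z' L' R' pos', ear_system (2 * W).+1 K Z' L' R' pos' /\ #|Z| < #|Z'|.
Proof.
move=> ears K0 hK hZ.
pose Y := ~: (K :|: Z).
have KY q : q \in Y -> q \notin K :|: Z by rewrite inE.
have grow y p : y \in Y -> #|Z| < #|Z :|: [set q in y :: p]|.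
  move=> yY; apply: proper_card; apply/properP; split; first exact: subsetUl.
  exists y; first by rewrite !inE eqxx orbT.
  by move: (KY y yY); rewrite inE negb_or => /andP[].
(* A vertex with two neighbors in [K] is an ear by itself. Otherwise each vertex of [Y] sends at
   most one edge to [K]. *)
have [/exists_inP[y yY /card_gt1P[a [b []]]]|no1] :=
    boolP [exists y in Y, 1 < #|[set a in K | adj E y a]|].
  rewrite !inE => /andP[aK ya] /andP[bK yb] ab.
  have [L' [R' [pos' ears']]] : exists L' R' pos',
      ear_system (2 * W).+1 K (Z :|: [set q in [:: y]]) L' R' pos'.
    apply: (@ear_system_add _ _ _ _ _ _ a b y [::] ears) => //.
    - by move=> q; rewrite mem_seq1 => /eqP ->; apply: KY.
    - by rewrite adj_sym.
  by exists (Z :|: [set q in [:: y]]), L', R', pos'; split=> //; apply: grow.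
pose e := [rel x y | [&& adj E x y, x \in Y & y \in Y]].
have e_sym : symmetric e by move=> x y; rewrite /= adj_sym andbA andbAC andbA.
pose F y := ball e W y.
pose Y1 := [set y in Y | [exists a in K, adj E y a]].
(* Meeting balls yield a path of at most 2 W edges, hence the bound of 2 W + 1 vertices on an
   ear. *)
have [/exists_inP[y yY1 /exists_inP[y' yY1' /andP[yy' /set0Pn[z /setIP[zy zy']]]]]|no2] :=
    boolP [exists y in Y1, [exists y' in Y1, (y != y') && (F y :&: F y' != set0)]].
  have /ball_path [p0 [pp0 pl0 ps0]] := ball_trans zy (ball_sym e_sym zy').
  move: pl0; case/shortenP: pp0 => p pp up sp pl.
  have ps : size p <= W + W.
    by apply: leq_trans ps0; apply: uniq_leq_size sp; case/andP: up.
  move: yY1 yY1'; rewrite ![_ \in Y1]inE => /andP[yY /exists_inP[a aK ya]].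
  move=> /andP[_ /exists_inP[b bK yb]].
  have pY : {in y :: p, forall q, q \in Y}.
    move=> q; rewrite inE => /orP[/eqP -> //|].
    elim: (p) (y) pp => //= w p' IHp x /andP[/and3P[_ _ wY] /IHp h].
    by rewrite inE => /orP[/eqP -> //|/h].
  have [L' [R' [pos' ears']]] : exists L' R' pos',
      ear_system (2 * W).+1 K (Z :|: [set q in y :: p]) L' R' pos'.
    apply: (@ear_system_add _ _ _ _ _ _ a b y p ears) => //.
    - by apply: sub_path pp => u w /and3P[].
    - by rewrite /= ltnS mul2n -addnn.
    - by move=> q /pY /KY.
    - by rewrite adj_sym.
    - by rewrite pl.
    - by move=> p0E; move: pl yy'; rewrite p0E /= => ->; rewrite eqxx.
  by exists (Z :|: [set q in y :: p]), L', R', pos'; split=> //; apply: grow.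
exfalso.
have dis : {in Y1 &, forall y y' x, x \in F y -> x \in F y' -> y = y'}.
  move=> y y' yY yY' x xy xy'; apply/eqP; apply: contraNT no2 => ne.
  apply/exists_inP; exists y => //; apply/exists_inP; exists y' => //.
  by rewrite ne; apply/set0Pn; exists x; rewrite inE xy.
have le1 y : y \in Y -> #|[set a in K | adj E y a]| <= 1.
  move=> yY; rewrite leqNgt; apply: contraNN no1 => gt.
  by apply/exists_inP; exists y.
have FY y j : y \in Y -> ball e j y \subset Y.
  move=> yY; elim: j => [|j IHj]; first by rewrite sub1set.
  rewrite subUset IHj; apply/subsetP=> x; rewrite inE => /exists_inP[w _].
  by case/and3P.
have Y1Y : {in Y1, forall y, F y \subset Y}.
  by move=> y; rewrite inE => /andP[yY _]; apply: FY.
have cutK : edge_cut E K <= #|Y1| + r * #|Z|.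
  apply: leq_trans (_ : edges_between E K (Y :|: Z) <= _).
    apply: subset_leq_card; apply/subsetP=> -[x y]; rewrite !inE /= => /and3P[-> yK ->].
    by rewrite (negPf yK) andbT orNb.
  apply: leq_trans (edges_betweenU _ _ _ _) _; apply: leq_add; last exact: edges_between_leqr.
  rewrite edges_between_sym edges_betweenE -sum1_card [leqRHS]big_mkcond [leqLHS]big_mkcond /=.
  apply: leq_sum => y _; rewrite [y \in Y1]inE; case: (boolP (y \in Y)) => //= yY.
  case: ifP => [_|/negbT no]; first exact: le1.
  rewrite leqn0 cards_eq0; apply: contraNT no => /set0Pn[a]; rewrite inE => /andP[aK ya].
  by apply/exists_inP; exists a.
(* Attached vertices whose ball touches [Z]. As the balls are disjoint, each is charged to its own
   edge into [Z]. *)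
pose U := [set y in Y1 | [exists w in F y, [exists z in Z, adj E w z]]].
have UY1 : U \subset Y1 by apply/subsetP=> y; rewrite inE => /andP[].
have cardU : #|U| <= r * #|Z|.
  apply: leq_trans (edges_between_leqr maxdeg Y Z).
  rewrite edges_betweenE.
  apply: leq_trans (sum_disjoint_leq (A := U) (F := F) _ _ _); last 2 first.
  - by move=> y y' /(subsetP UY1) yY1 /(subsetP UY1) yY1'; apply: dis.
  - by move=> y /(subsetP UY1); apply: Y1Y.
  rewrite -sum1_card; apply: leq_sum => y; rewrite inE.
  move=> /andP[_ /exists_inP[w wF /exists_inP[z zZ wz]]].
  rewrite (bigD1 w) //=; apply: leq_trans (leq_addr _ _).
  by apply/card_gt0P; exists z; rewrite inE zZ.
have clean y : y \in Y1 :\: U -> W < #|F y|.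
  rewrite inE => /andP[yU yY1]; have := yY1; rewrite [_ \in Y1]inE => /andP[yY _].
  apply: card_ball_gt => j jW; apply/negP => /eqP stuck.
  set B := ball e j y in stuck.
  have BF : B \subset F y by apply: ball_sub; apply: ltnW.
  have BY : B \subset Y by apply: FY.
  have : 2 <= edge_cut E B.
    apply: (cut_ge2 t_gt0 expands); apply/andP; split.
      by apply/card_gt0P; exists y; apply: ball_center.
    have : #|B| + #|K| <= n.
      rewrite -[leqRHS]card_ord -cardsUI (_ : B :&: K = set0) ?cards0 ?addn0 ?max_card //.
      apply/setP=> x; rewrite !inE; apply/negP => /andP[/(subsetP BY)/KY xN xK].
      by move: xN; rewrite inE xK.
    by apply: leq_trans; rewrite -addn1 leq_add2l.
  rewrite ltnNge => /negP; apply; apply: leq_trans (le1 y yY).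
  have -> : #|[set a in K | adj E y a]| = edges_between E [set y] K.
    by rewrite edges_betweenE big_set1.
  apply: subset_leq_card; apply/subsetP=> -[w x].
  rewrite ![_ \in cross_pairs _ _ _]inE /= in_setC => /and3P[wB xB wx].
  have xK : x \in K.
    apply: contraNT xB => xK; have [xZ|xZ] := boolP (x \in Z).
      move: yU; rewrite inE yY1 => /negP[]; apply/exists_inP; exists w.
        exact: (subsetP BF).
      by apply/exists_inP; exists x.
    rewrite stuck; apply: (nbh_edge wB); rewrite /= wx (subsetP BY _ wB).
    by rewrite !inE negb_or xK.
  rewrite xK wx !andbT inE; apply/eqP/(dis w y _ yY1 w).
  - rewrite inE (subsetP BY _ wB); apply/exists_inP; exists x => //.
  - exact: ball_center.
  - exact: (subsetP BF).
have many : W.+1 * #|Y1 :\: U| <= #|~: K|.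
  apply: leq_trans (_ : \sum_(y in Y1 :\: U) \sum_(x in F y) 1 <= _).
    rewrite mulnC -sum_nat_const; apply: leq_sum => y /clean; by rewrite sum1_card.
  apply: leq_trans (sum_disjoint_leq (B := Y) _ _ _) _.
  - by move=> y y'; rewrite !in_setD => /andP[_ yY] /andP[_ yY']; apply: dis.
  - by move=> y; rewrite in_setD => /andP[_]; apply: Y1Y.
  rewrite sum1_card; apply/subset_leq_card/subsetP=> x; rewrite !inE.
  by rewrite negb_or => /andP[].
have cardD : #|Y1| <= #|Y1 :\: U| + #|U|.
  by rewrite cardsD (setIidPr UY1); have := subset_leq_card UY1; lia.
move: (edge_cut E K) #|~: K| #|Y1 :\: U| #|Y1| #|U| #|Z| hK hZ cutK cardU many cardD.
clear=> C q y0 y1 u z hK hZ cutK cardU many cardD.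
(* The contradiction: 2 q <= W C <= W y0 + 2 r W z < W y0 + q, whereas (W + 1) y0 <= q. *)
have h1 : C <= y0 + 2 * (r * z) by lia.
have h2 : W * C <= W * y0 + 2 * r * W * z by nia.
nia.
Qed.

Lemma ear_saturate W K : 0 < #|K| -> 2 * #|~: K| <= W * edge_cut E K ->
  exists Z L R pos, ear_system (2 * W).+1 K Z L R pos /\ #|~: K| <= 2 * r * W * #|Z|.
Proof.
move=> K0 hK.
suff H m Z L R pos : ear_system (2 * W).+1 K Z L R pos -> n - #|Z| <= m ->
    exists Z L R pos, ear_system (2 * W).+1 K Z L R pos /\ #|~: K| <= 2 * r * W * #|Z|.
  by apply: (H n set0 id id (fun=> 0)); [move=> q; rewrite inE | rewrite leq_subr].
elim: m Z L R pos => [|m IHm] Z L R pos ears Zm;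
  have [le|gt] := leqP #|~: K| (2 * r * W * #|Z|); try by exists Z, L, R, pos.
  have [Z' [_ [_ [_ [_ ZZ']]]]] := ear_extend ears K0 hK gt.
  have : #|Z'| <= n by rewrite -[leqRHS]card_ord max_card.
  by move: Zm ZZ'; clear; lia.
have [Z' [L' [R' [pos' [ears' ZZ']]]]] := ear_extend ears K0 hK gt.
by apply: (IHm _ _ _ _ ears'); move: Zm ZZ'; clear; lia.
Qed.

End Ears.

(** * Logarithmically many generations of ears *)

Section Expander.
Variables (n : nat) (E : edge_set n) (r t : nat).
Hypothesis maxdeg : forall x, #|[set y | adj E x y]| <= r.
Hypothesis t_gt0 : 0 < t.
Hypothesis expands : forall X : {set 'I_n},
  0 < #|X| -> 2 * #|X| <= n -> 2 * (#|X| %/ t).+1 <= edge_cut E X.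

(** The density of [K] turns a cut linear in [K] into one linear in the complement. When [K] exceeds
    half of the vertices, the complement is expanded directly. *)
Lemma cut_dense M0 (K : {set 'I_n}) : 0 < #|K| -> n <= M0 * #|K| ->
  2 * #|~: K| <= t * M0 * edge_cut E K.
Proof.
move=> K0 nK; have cK := cardsC K; rewrite card_ord in cK.
have [le|gt] := leqP (2 * #|K|) n.
  have lo := cut_lower t_gt0 expands K0 le.
  have h1 : 2 * #|~: K| <= M0 * (2 * #|K|) by move: cK nK; clear; nia.
  by apply: (leq_trans h1); rewrite mulnAC mulnC leq_mul2r lo orbT.
have [->|Q0] := posnP #|~: K|; first by rewrite muln0.
have M1 : 0 < M0 by move: nK cK K0; case: (M0) => //; clear; lia.
have lo : 2 * #|~: K| <= t * edge_cut E (~: K).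
  by apply: (cut_lower t_gt0 expands Q0); move: gt cK; clear; lia.
rewrite cutC in lo; apply: (leq_trans lo).
by rewrite -mulnA leq_mul2l leq_pmull ?orbT.
Qed.

Hypothesis r_gt0 : 0 < r.
Variable M0 : nat.
Hypothesis M0_gt0 : 0 < M0.
(** [W] is the radius that [cut_dense] provides for [ear_extend], 1 / [M] the fraction of the
    remaining vertices covered by a generation, and [l] its number of colors: an ear with 2 W + 1
    vertices has 2 W + 2 edges. *)
Let W := t * M0.
Let M := 2 * r * W.
Let l := (2 * W).+2.

Lemma ear_generation (K : {set 'I_n}) k : 0 < #|K| -> n <= M0 * #|K| -> rainbow_on E K k ->
  exists K' : {set 'I_n}, [/\ 0 < #|K'|, n <= M0 * #|K'|, rainbow_on E K' (k + l) &
    M * #|~: K'| + #|~: K| <= M * #|~: K|].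
Proof.
move=> K0 nK Kk.
have [Z [L [R [pos [ears le]]]]] := ear_saturate maxdeg t_gt0 expands K0 (cut_dense K0 nK).
have sK : #|K| <= #|K :|: Z| by apply/subset_leq_card/subsetUl.
exists (K :|: Z); split.
- exact: leq_trans sK.
- by apply: (leq_trans nK); rewrite leq_mul2l sK orbT.
- exact: ear_rainbow ears Kk.
have KZ : [disjoint K & Z].
  rewrite disjoint_sym; apply/pred0P => q /=; apply/negP => /andP[/ears[[qK _] _ _ _ _]].
  exact/negP.
have cU : #|K :|: Z| = #|K| + #|Z| by apply/eqP; rewrite (leq_card_setU K Z).
have := cardsC K; have := cardsC (K :|: Z); rewrite cU card_ord.
rewrite -/W -/M in le; move: le; move: #|~: (K :|: Z)| #|~: K| #|K| #|Z|.
move: (M); clear => m q' q a z le e1 e2.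
have -> : q = q' + z by lia.
by rewrite mulnDr leq_add2l; move: le; have -> : q = q' + z by lia.
Qed.

(** While at least [h] vertices are uncovered, a generation lowers [M] times their number by [h].
    With h = 2 ^ e, [M] generations bring it from below 2 h to below h. *)
Lemma ear_generations j h (K : {set 'I_n}) k : 0 < #|K| -> n <= M0 * #|K| -> rainbow_on E K k ->
  exists K' : {set 'I_n}, [/\ 0 < #|K'|, n <= M0 * #|K'|, rainbow_on E K' (k + l * j) &
    (#|~: K'| < h) || (M * #|~: K'| + j * h <= M * #|~: K|)].
Proof.
move=> K0 nK Kk; elim: j => [|j [K1 [K10 nK1 K1k IHj]]].
  by exists K; split=> //; rewrite ?muln0 ?addn0 // leqnn orbT.
have [K2 [K20 nK2 K2k le]] := ear_generation K10 nK1 K1k.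
have kE : k + l * j.+1 = k + l * j + l by rewrite mulnS [l + _]addnC addnA.
exists K2; split; rewrite ?kE //.
have M_gt0 : 0 < M by rewrite !muln_gt0 r_gt0 t_gt0.
have q21 : #|~: K2| <= #|~: K1|.
  by rewrite -(leq_pmul2l M_gt0); apply: leq_trans le; apply: leq_addr.
case/orP: IHj => [lt|IHj]; first by rewrite (leq_ltn_trans q21 lt).
have [//|hq2 /=] := ltnP #|~: K2| h.
rewrite mulSn; move: (leq_trans hq2 q21) le IHj.
move: (M * _) (M * _) (M * _) (j * h) => a b c d; clear; lia.
Qed.

Lemma rainbow_full e (K : {set 'I_n}) k : 0 < #|K| -> n <= M0 * #|K| -> rainbow_on E K k ->
  #|~: K| < 2 ^ e -> rainbow_on E setT (k + l * M * e).
Proof.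
elim: e K k => [|e IHe] K k K0 nK Kk.
  rewrite expn0 ltnS leqn0 cards_eq0 muln0 addn0 => /eqP KC.
  by rewrite -(setCK K) KC setC0 in Kk.
rewrite expnS => Ke; have [K' [K'0 nK' K'k H]] := ear_generations M (2 ^ e) K0 nK Kk.
rewrite mulnS addnA; apply: IHe K'0 nK' K'k _.
have M_gt0 : 0 < M by rewrite !muln_gt0 r_gt0 t_gt0.
case/orP: H => // H; rewrite -(ltn_pmul2l M_gt0); move: H Ke.
rewrite -(ltn_pmul2l M_gt0); move: (2 ^ e) #|~: K| #|~: K'| (M); clear; lia.
Qed.

Theorem expander_rainbow : 2 * r <= n -> M0 = 2 * r * r * t ->
  rainbow_colorable E ((3 * (half_radius n r t + half_radius n r t).+1).+1 +
    l * M * (trunc_log 2 n).+1).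
Proof.
move=> rn M0E; have [K nK Kk] := rainbow_core maxdeg t_gt0 expands r_gt0 rn.
apply: rainbow_on_colorable => //; rewrite -M0E in nK.
have K0 : 0 < #|K|.
  by move: nK; case: (#|K|) => //; rewrite muln0 leqn0; move: rn r_gt0; clear; lia.
apply: rainbow_full K0 nK Kk _; apply: leq_ltn_trans (trunc_log_ltn n (isT : 1 < 2)).
by rewrite -[leqRHS]card_ord max_card.
Qed.

End Expander.

(** * Switchings *)

Lemma card_dep (T1 T2 : finType) (P : {set T1}) (Q : T1 -> {set T2}) :
  #|[set z : T1 * T2 | (z.1 \in P) && (z.2 \in Q z.1)]| = \sum_(a in P) #|Q a|.
Proof.
rewrite -sum1_card (eq_bigl (fun z : T1 * T2 => (z.1 \in P) && (z.2 \in Q z.1))); last first.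
  by move=> z; rewrite inE.
rewrite -(pair_big_dep (mem P) (fun a b => b \in Q a) (fun _ _ => 1)) /=.
by apply: eq_bigr => a _; rewrite sum1_card.
Qed.

Lemma exists_subset_card (T : finType) (S : {set T}) m : m <= #|S| ->
  exists2 A : {set T}, A \subset S & #|A| = m.
Proof.
move=> mS; exists [set x in take m (enum S)].
  by apply/subsetP=> x; rewrite inE => /mem_take; rewrite mem_enum.
by rewrite cardsE (card_uniqP (take_uniq _ (enum_uniq _))) size_takel // -cardE.
Qed.

Section EdgeSets.
Variable n : nat.
Implicit Types (A E : edge_set n) (X : {set 'I_n}).

Definition ends A := [set p : 'I_n * 'I_n | [set p.1; p.2] \in A].

Lemma set2_inj (a b x y : 'I_n) :
  [set a; b] = [set x; y] -> (a = x /\ b = y) \/ (a = y /\ b = x).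
Proof.
move=> e; have : a \in [set x; y] by rewrite -e !inE eqxx.
have : b \in [set x; y] by rewrite -e !inE eqxx orbT.
have : x \in [set a; b] by rewrite e !inE eqxx.
have : y \in [set a; b] by rewrite e !inE eqxx orbT.
rewrite !inE; have [-> /= yb _ bxy _|ax _ xb _ /=] := eqVneq a x.
  left; split=> //; apply/eqP; case/orP: bxy => // /eqP bx.
  by move: yb; rewrite bx orbb eq_sym.
move=> /eqP ay; right; split=> //; apply/eqP.
by rewrite eq_sym.
Qed.

Lemma card_ends A : is_graph A -> #|ends A| = 2 * #|A|.
Proof.
move=> /forall_inP gA.
rewrite -sum1_card (partition_big (fun p : 'I_n * 'I_n => [set p.1; p.2]) (mem A)) /=; last first.
  by move=> p; rewrite inE.
rewrite mulnC -sum_nat_const; apply: eq_bigr => e eA.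
have /cards2P[a [b [ab eE]]] := gA e eA.
rewrite sum1_card -[RHS](_ : #|[set (a, b); (b, a)]| = 2); last first.
  by rewrite cards2 xpair_eqE (negPf ab).
apply: eq_card => -[x y]; rewrite [LHS]unfold_in /= !inE !xpair_eqE /=.
apply/andP/orP => [[_ /eqP]|].
  by rewrite eE => /set2_inj[] [-> ->]; rewrite !eqxx; [left|right].
case=> /andP[/eqP -> /eqP ->]; first by rewrite -eE eA eqxx.
by rewrite setUC -eE eA eqxx.
Qed.

Lemma degree_adj E x : is_graph E -> degree E x = #|[set y | adj E x y]|.
Proof.
move=> gE; have inj : {in [set y | adj E x y] &, injective (fun y => [set x; y])}.
  move=> y z _ _ /set2_inj[[_ //]|[-> ->] //].
rewrite /degree -(card_in_imset inj); apply: eq_card => e.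
rewrite inE; apply/andP/imsetP => [[eE xe]|[y]].
  have /cards2P[a [b [ab eE']]] := forall_inP gE e eE.
  move: xe; rewrite eE' !inE => /orP[]/eqP ->; [exists b | exists a] => //;
    by rewrite ?inE /adj ?(setUC [set b]) -?eE'.
by rewrite inE /adj => xy ->; rewrite xy !inE eqxx.
Qed.

Lemma degree_sum E x : degree E x = \sum_(e in E) (x \in e).
Proof.
rewrite /degree -sum1_card big_mkcond [RHS]big_mkcond /=.
by apply: eq_bigr => e _; rewrite inE; case: (e \in E); case: (x \in e).
Qed.

Lemma is_graph_sub A E : A \subset E -> is_graph E -> is_graph A.
Proof. by move=> /subsetP AE /forall_inP gE; apply/forall_inP => e /AE/gE. Qed.

Section Switching.
Variable r : nat.

Lemma regular_graph E : E \in regular_graphs n r -> is_graph E.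
Proof. by rewrite inE => /andP[]. Qed.

Lemma regular_degree E x : E \in regular_graphs n r -> degree E x = r.
Proof. by rewrite inE => /andP[_ /forallP /(_ x) /eqP]. Qed.

Lemma regular_adj E x : E \in regular_graphs n r -> #|[set y | adj E x y]| = r.
Proof. by move=> rE; rewrite -degree_adj ?(regular_degree x rE) // (regular_graph rE). Qed.

Definition switch E (u v x y : 'I_n) :=
  [set u; x] |: ([set v; y] |: (E :\ [set u; v] :\ [set x; y])).

(** Neither new edge is a loop or already present, so the graph stays simple; the remaining
    inequalities follow in [switchable_neq]. *)
Definition switchable E (u v x y : 'I_n) :=
  [&& [set u; v] \in E, [set x; y] \in E,
      x != u, [set u; x] \notin E, y != v & [set v; y] \notin E].

Lemma switchable_neq E u v x y : is_graph E -> switchable E u v x y ->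
  [/\ u != v, x != y, x != v & y != u].
Proof.
move=> gE /and5P[uv xy xu ux /andP[yv vy]]; split.
- exact: adj_neq gE uv.
- exact: adj_neq gE xy.
- by apply: contraNneq vy => <-.
- by apply: contraNneq ux => <-; rewrite setUC.
Qed.

Lemma set2_neq (a b x y : 'I_n) : a != x -> a != y -> [set a; b] != [set x; y].
Proof. by move=> ax ay; apply/eqP => /set2_inj[[/eqP]|[/eqP]]; rewrite ?(negPf ax) ?(negPf ay). Qed.

Lemma switchK E u v x y : is_graph E -> switchable E u v x y ->
  [set u; v] |: ([set x; y] |: (switch E u v x y :\ [set u; x] :\ [set v; y])) = E.
Proof.
move=> gE sE; have [nuv nxy nxv nyu] := switchable_neq gE sE.
have /and5P[uv xy xu ux /andP[yv vy]] := sE.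
apply/setP=> e; rewrite !inE.
have [->|e1] := eqVneq e [set u; v]; first by rewrite uv.
have [->|e2] := eqVneq e [set x; y]; first by rewrite xy.
have [->|e3] := eqVneq e [set u; x]; first by rewrite (negPf ux) /= andbF.
by have [->|e4] := eqVneq e [set v; y]; first by rewrite (negPf vy).
Qed.

Lemma switch_regular E u v x y : E \in regular_graphs n r ->
  switchable E u v x y -> switch E u v x y \in regular_graphs n r.
Proof.
move=> rE sE; have gE := regular_graph rE.
have [nuv nxy nxv nyu] := switchable_neq gE sE.
have /and5P[uv xy xu ux /andP[yv vy]] := sE.
rewrite inE; apply/andP; split.
  apply/forall_inP => e; rewrite !inE => /or3P[/eqP->|/eqP->|/and3P[_ _]].
  - by rewrite cards2 [u == x]eq_sym xu.
  - by rewrite cards2 [v == y]eq_sym yv.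
  - exact: (forall_inP gE).
apply/forallP => z; rewrite -(regular_degree z rE) !degree_sum /switch.
have n1 : [set v; y] \notin E :\ [set u; v] :\ [set x; y] by rewrite !inE (negPf vy) !andbF.
have n2 : [set u; x] \notin [set v; y] |: (E :\ [set u; v] :\ [set x; y]).
  rewrite !inE (negPf ux) !andbF orbF; apply: set2_neq => //.
  by rewrite eq_sym.
rewrite (big_setU1 _ n2) (big_setU1 _ n1) /=.
have xy' : [set x; y] \in E :\ [set u; v].
  rewrite !inE xy andbT; exact: set2_neq.
have mem2 (a b : 'I_n) : a != b -> (z \in [set a; b] : nat) = (z == a) + (z == b).
  by move=> ab; rewrite !inE; have [->|_] := eqVneq z a; [rewrite (negPf ab)|].
rewrite (big_setD1 _ uv) (big_setD1 _ xy') /= !addnA eqn_add2r.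
rewrite (mem2 u v) // (mem2 x y) // (mem2 u x) 1?eq_sym // (mem2 v y) 1?eq_sym //.
by case: (z == u); case: (z == v); case: (z == x); case: (z == y).
Qed.

Variable X : {set 'I_n}.

Definition marked m := [set q : edge_set n * edge_set n |
  [&& q.1 \in regular_graphs n r, q.2 \subset q.1,
      [forall e in q.2, e \subset X] & #|q.2| == m]].

(** Marked edges lie inside [X], so both of their orientations start in [X] and are subtracted. *)
Lemma card_backward E A m : (E, A) \in marked m ->
  #|[set p in ends (E :\: A) | p.1 \in X]| = r * #|X| - 2 * m.
Proof.
rewrite inE /= => /and4P[rE AE /forall_inP AX /eqP <-].
have gE := regular_graph rE.
rewrite -card_ends ?(is_graph_sub AE) //.
have -> : [set p in ends (E :\: A) | p.1 \in X] =
    [set p in ends E | p.1 \in X] :\: ends A.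
  by apply/setP=> p; rewrite !inE; case: (_ \in A); case: (_ \in E).
rewrite cardsD; congr (_ - _).
  have -> : #|[set p in ends E | p.1 \in X]| = edges_between E X setT.
    by apply: eq_card => p; rewrite !inE /= /adj andbC.
  rewrite edges_betweenE mulnC -sum_nat_const; apply: eq_bigr => x _.
  by rewrite -(regular_adj x rE); apply: eq_card => y; rewrite !inE.
congr #|pred_of_set _|; apply/setIidPr/subsetP => p; rewrite !inE => pA.
rewrite (subsetP AE _ pA) /=; apply: (subsetP (AX _ pA)).
by rewrite !inE eqxx.
Qed.

(** Of the r n oriented edges xy, the excluded ones are marked, or have x equal or adjacent to u, or
    y equal or adjacent to v. Each of the last two conditions concerns r + 1 vertices with r edges
    each. *)
Lemma card_forward E A m (p : 'I_n * 'I_n) : (E, A) \in marked m -> p \in ends A ->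
  r * n - 2 * m - 2 * (r * r.+1) <=
  #|[set q in ends (E :\: A) | switchable E p.1 p.2 q.1 q.2]|.
Proof.
case: p => u v; rewrite inE /= => /and4P[rE AE /forall_inP AX /eqP <-].
rewrite inE /= => uvA; have gE := regular_graph rE.
have uvE := subsetP AE _ uvA.
rewrite -card_ends ?(is_graph_sub AE) //.
have nE w : #|w |: [set y | adj E w y]| <= r.+1.
  by rewrite cardsU1 (regular_adj w rE) -add1n leq_add2r leq_b1.
have maxdeg w : #|[set y | adj E w y]| <= r by rewrite (regular_adj w rE).
pose B1 := cross_pairs E (u |: [set y | adj E u y]) setT.
pose B2 := cross_pairs E setT (v |: [set y | adj E v y]).
have cB1 : #|B1| <= r * r.+1.
  by apply: leq_trans (edges_between_leql maxdeg _ _) _; rewrite leq_mul2l nE orbT.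
have cB2 : #|B2| <= r * r.+1.
  by apply: leq_trans (edges_between_leqr maxdeg _ _) _; rewrite leq_mul2l nE orbT.
have cE : #|ends E| = r * n.
  have -> : #|ends E| = edges_between E setT setT.
    by apply: eq_card => p; rewrite !inE.
  rewrite edges_betweenE mulnC -[in RHS](card_ord n) -cardsT -sum_nat_const.
  apply: eq_bigr => x _; rewrite -(regular_adj x rE); apply: eq_card => y; by rewrite !inE.
set S := [set q in _ | _].
have sub : ends E \subset S :|: ends A :|: B1 :|: B2.
  apply/subsetP => q qE; rewrite 3!in_setU.
  have [|qB2] := boolP (q \in B2); first by rewrite !orbT.
  have [|qB1] := boolP (q \in B1); first by rewrite !orbT.
  have [|qA] := boolP (q \in ends A); first by rewrite !orbT.
  rewrite !orbF; move: qE qA qB1 qB2; case: q => x y; rewrite !inE /= /adj.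
  move=> xyE xyA; rewrite xyE xyA !andbT !negb_or /switchable uvE xyE /=.
  by move=> /andP[-> ->] /andP[-> ->].
have : r * n <= #|S| + #|ends A| + #|B1| + #|B2|.
  rewrite -cE; apply: leq_trans (subset_leq_card sub) _.
  do 2 (apply: leq_trans (leq_card_setU _ _) _; rewrite leq_add2r).
  exact: leq_card_setU.
move: cB1 cB2; clearbody S B1 B2; clear.
move: (r * r.+1) (r * n) #|S| #|ends A| #|B1| #|B2| => *; lia.
Qed.

(* Double counting of the switchings of a marked edge uv with an unmarked edge xy: the reverse
   switching is determined by the unmarked oriented edges ux and vy, both starting in X. *)
Lemma marked_step m :
  #|marked m.+1| * (2 * m.+1 * (r * n - 2 * m.+1 - 2 * (r * r.+1))) <=
  #|marked m| * (r * #|X| - 2 * m) ^ 2.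
Proof.
pose D (q : edge_set n * edge_set n) := [set p in ends (q.1 :\: q.2) | p.1 \in X].
pose F (q : edge_set n * edge_set n) (p : 'I_n * 'I_n) :=
  [set w in ends (q.1 :\: q.2) | switchable q.1 p.1 p.2 w.1 w.2].
pose Q (q : edge_set n * edge_set n) :=
  [set w : ('I_n * 'I_n) * ('I_n * 'I_n) | (w.1 \in ends q.2) && (w.2 \in F q w.1)].
pose S1 := [set z : (edge_set n * edge_set n) * (('I_n * 'I_n) * ('I_n * 'I_n)) |
  (z.1 \in marked m.+1) && (z.2 \in Q z.1)].
pose S2 := [set z : (edge_set n * edge_set n) * (('I_n * 'I_n) * ('I_n * 'I_n)) |
  (z.1 \in marked m) && (z.2 \in setX (D z.1) (D z.1))].
have le1 : #|marked m.+1| * (2 * m.+1 * (r * n - 2 * m.+1 - 2 * (r * r.+1))) <= #|S1|.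
  rewrite card_dep -sum_nat_const; apply: leq_sum => -[E A] qM.
  have := qM; rewrite inE /= => /and4P[rE AE _ /eqP cA].
  have ce : #|ends A| = 2 * m.+1.
    by rewrite card_ends ?cA //; apply: is_graph_sub AE (regular_graph rE).
  rewrite /Q card_dep -{1}ce -sum_nat_const; apply: leq_sum => p pA.
  exact: card_forward qM pA.
have -> : #|marked m| * (r * #|X| - 2 * m) ^ 2 = #|S2|.
  rewrite (card_dep (marked m) (fun q => setX (D q) (D q))) -sum_nat_const.
  apply: eq_bigr => -[E A] qM.
  by rewrite cardsX (card_backward qM) mulnn.
apply: leq_trans le1 _.
pose f (z : (edge_set n * edge_set n) * (('I_n * 'I_n) * ('I_n * 'I_n))) :=
  let: ((E, A), ((u, v), (x, y))) := z in
  ((switch E u v x y, A :\ [set u; v]), ((u, x), (v, y))).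
have S1P E A u v x y : ((E, A), ((u, v), (x, y))) \in S1 ->
  [/\ (E, A) \in marked m.+1, [set u; v] \in A, [set x; y] \notin A & switchable E u v x y].
  by rewrite [_ \in S1]inE /= => /andP[-> ]; rewrite !inE /= => /and3P[-> /andP[-> _] ->].
have finj : {in S1 &, injective f}.
  move=> [[E A] [[u v] [x y]]] [[E' A'] [[u' v'] [x' y']]] /S1P[qM uvA _ sE] /S1P[qM' uvA' _ sE'].
  move=> [eS eA ? ? ? ?]; subst u' v' x' y'.
  move: qM qM'; rewrite ![_ \in marked _]inE /= => /andP[rE _] /andP[rE' _].
  have eE : E = E'.
    by rewrite -(switchK (regular_graph rE) sE) eS (switchK (regular_graph rE') sE').
  by rewrite eE -(setD1K uvA) eA (setD1K uvA').
rewrite -(card_in_imset finj); apply/subset_leq_card/subsetP => z /imsetP[[[E A] [[u v] [x y]]]].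
move=> /S1P[qM uvA xyA sE] -> {z}; rewrite /f inE /=.
move: qM; rewrite inE /= => /and4P[rE AE /forall_inP AX /eqP cA].
have gE := regular_graph rE; have [nuv nxy nxv nyu] := switchable_neq gE sE.
have /and5P[uv xy xu ux /andP[yv vy]] := sE.
have uX : u \in X by apply: (subsetP (AX _ uvA)); rewrite !inE eqxx.
have vX : v \in X by apply: (subsetP (AX _ uvA)); rewrite !inE eqxx orbT.
have uxA : [set u; x] \notin A by apply: contra ux => /(subsetP AE).
have vyA : [set v; y] \notin A by apply: contra vy => /(subsetP AE).
apply/andP; split.
  rewrite inE /= (switch_regular rE sE) /=; apply/and3P; split.
  - apply/subsetP => e; rewrite !inE => /andP[euv eA].
    rewrite euv (subsetP AE _ eA) !andbT.
    have -> : e != [set x; y] by apply: contraNneq xyA => <-.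
    by rewrite !orbT.
  - by apply/forall_inP => e; rewrite !inE => /andP[_ /AX].
  - by move: cA; rewrite (cardsD1 [set u; v]) uvA add1n => -[->].
by rewrite !inE /= (negPf uxA) (negPf vyA) uX vX !eqxx !andbF !orbT.
Qed.

Definition inner_edges E := [set e in E | e \subset X].

Lemma marked_product m :
  #|marked m| * \prod_(i < m) (2 * i.+1 * (r * n - 2 * i.+1 - 2 * (r * r.+1))) <=
  #|regular_graphs n r| * \prod_(i < m) (r * #|X| - 2 * i) ^ 2.
Proof.
elim: m => [|m IHm].
  rewrite !big_ord0 !muln1.
  have inj : {in marked 0 &, injective fst}.
    move=> [E A] [E' A']; rewrite !inE /= !cards_eq0.
    by move=> /and4P[_ _ _ /eqP ->] /and4P[_ _ _ /eqP ->] ->.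
  rewrite -(card_in_imset inj); apply/subset_leq_card/subsetP => _ /imsetP[q qM ->].
  by move: qM; rewrite inE => /andP[].
rewrite !big_ord_recr /= mulnCA mulnC.
apply: leq_trans (leq_mul (marked_step m) (leqnn _)) _.
by rewrite mulnAC [leqRHS]mulnA leq_mul2r IHm orbT.
Qed.

Lemma dense_count m :
  #|[set E in regular_graphs n r | m <= #|inner_edges E|]| <= #|marked m|.
Proof.
apply: leq_trans (leq_imset_card fst (marked m)).
apply/subset_leq_card/subsetP => E; rewrite inE => /andP[rE /exists_subset_card[A AX cA]].
apply/imsetP; exists (E, A) => //; rewrite inE /= rE cA eqxx andbT /=.
apply/andP; split.
  by apply: subset_trans AX _; apply/subsetP => e; rewrite inE => /andP[].
by apply/forall_inP => e /(subsetP AX); rewrite inE => /andP[].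
Qed.

Lemma dense_product m :
  #|[set E in regular_graphs n r | m <= #|inner_edges E|]| *
    \prod_(i < m) (2 * i.+1 * (r * n - 2 * i.+1 - 2 * (r * r.+1))) <=
  #|regular_graphs n r| * \prod_(i < m) (r * #|X| - 2 * i) ^ 2.
Proof. by apply: leq_trans (marked_product m); rewrite leq_mul2r dense_count orbT. Qed.

Lemma cut_inner E : E \in regular_graphs n r ->
  edge_cut E X + 2 * #|inner_edges E| = r * #|X|.
Proof.
move=> rE; have gE := regular_graph rE.
have gI : is_graph (inner_edges E).
  by apply: is_graph_sub gE; apply/subsetP => e; rewrite inE => /andP[].
rewrite -(card_ends gI) mulnC -sum_nat_const.
rewrite (eq_bigr (fun x => #|[set y in ~: X | adj E x y]| + #|[set y in X | adj E x y]|)).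
  rewrite big_split /= -!edges_betweenE; congr (_ + _); apply: eq_card => -[x y].
  rewrite !inE /= subUset !sub1set /adj.
  by case: (x \in X); case: (y \in X); rewrite ?andbT ?andbF.
move=> x _; rewrite -(regular_adj x rE) -cardsUI.
rewrite [X in _ + X](_ : _ = 0) ?addn0.
  by apply: eq_card => y; rewrite !inE; case: (y \in X); rewrite ?orbF.
apply/eqP; rewrite cards_eq0; apply/eqP/setP => y; rewrite !inE.
by case: (y \in X); rewrite /= ?andbF.
Qed.

End Switching.
End EdgeSets.

Import Order.TTheory GRing.Theory Num.Theory.

(** * Existence of regular graphs *)

(** Existence is needed because [Pr_regular] is 0 when there is no regular graph. The sums are
    modulo N + 1: x and y are adjacent when y - x lies in [S]. *)
Lemma circulant_regular N (S : {set 'I_N.+1}) :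
  (forall s, s \in S -> - s \in S)%R -> (0%R \notin S) ->
  exists E : edge_set N.+1, E \in regular_graphs N.+1 #|S|.
Proof.
move=> SN S0.
pose E : edge_set N.+1 := [set e | [exists x, [exists s in S, e == [set x; (x + s)%R]]]].
have adjE x y : adj E x y = ((y - x)%R \in S).
  rewrite /adj inE; apply/existsP/idP => [[u /exists_inP[s sS /eqP/set2_inj[[-> ->]|[-> ->]]]]|yx].
  - by rewrite addrC addKr.
  - by rewrite opprD addrA subrr add0r SN.
  - by exists x; apply/exists_inP; exists (y - x)%R; rewrite // addrC subrK.
have gE : is_graph E.
  apply/forall_inP => e; rewrite inE => /existsP[u /exists_inP[s sS /eqP ->]].
  rewrite cards2; have -> // : u != (u + s)%R.
  by apply: contraNneq S0 => us; rewrite -(addrK u s) [(s + u)%R]addrC -us subrr in sS.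
exists E; rewrite inE gE; apply/forallP => x; rewrite degree_adj //.
have inj : injective (fun s => x + s)%R by apply: addrI.
rewrite -(card_imset (mem S) inj); apply/eqP/eq_card => y; rewrite inE adjE.
apply/idP/imsetP => [yx|[s sS ->]]; first by exists (y - x)%R; rewrite // addrC subrK.
by rewrite addrC addKr.
Qed.

(* A circulant graph; for r odd, n is even and n / 2 is added to the connection set. *)
Lemma regular_graphs_neq0 n r : r < n -> ~~ odd (r * n) -> 0 < #|regular_graphs n r|.
Proof.
case: n => // N rN even_rn; apply/card_gt0P.
pose h := r./2; pose n := N.+1.
have rh : r = odd r + h.*2 by rewrite odd_double_half.
pose P s := [|| 0 < s <= h, n - h <= s | odd r && (s.*2 == n)].
pose S := [set s : 'I_N.+1 | P s].
have hn : h.*2 < n by rewrite /n; move: rN; rewrite {1}rh; lia.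
have cS : #|S| = r.
  have -> : #|S| = count P (iota 0 n).
    rewrite /n -val_enum_ord count_map.
    transitivity (count (mem S) (enum 'I_N.+1)).
      by rewrite cardE -size_filter [in RHS]enumT.
    by apply: eq_count => s; rewrite /= inE.
  have nE : n = 1 + (h + ((n - h.*2).-1 + h)) by lia.
  rewrite {1}nE !iotaD !count_cat /= add0n.
  have -> : P 0 = false by rewrite /P /=; lia.
  have -> : count P (iota 1 h) = h.
    rewrite -[RHS](size_iota 1 h) -count_predT; apply: eq_in_count => s.
    by rewrite mem_iota /P /=; lia.
  have -> : count P (iota (1 + h + (n - h.*2).-1) h) = h.
    rewrite -[RHS](size_iota (1 + h + (n - h.*2).-1) h) -count_predT.
    by apply: eq_in_count => s; rewrite mem_iota /P /=; lia.
  have -> : count P (iota (1 + h) (n - h.*2).-1) = odd r.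
    transitivity (count (fun s => odd r && (s.*2 == n)) (iota (1 + h) (n - h.*2).-1)).
      apply: eq_in_count => s; rewrite mem_iota /P /=; lia.
    case: (boolP (odd r)) => [ro|_] /=; last by rewrite count_pred0.
    have ne : ~~ odd n by move: even_rn; rewrite oddM ro.
    have nh : n = (n./2).*2 by rewrite -[LHS]odd_double_half (negPf ne).
    rewrite (eq_count (a2 := pred1 n./2)) ?count_uniq_mem ?iota_uniq // ?mem_iota.
      by move: rh; rewrite ro => rh; have : r < n := rN; lia.
    by move=> s /=; lia.
  by rewrite [in RHS]rh; lia.
have [||E rE] := @circulant_regular N S; last by exists E; rewrite -cS.
- move=> s; rewrite !inE /P /=; have sn := ltn_ord s.
  have [s0|s0] := posnP s; first by rewrite s0 subn0 modnn.
  by rewrite modn_small; lia.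
- by rewrite inE /P /= /n; lia.
Qed.

(** * The union bound *)

Definition expanding n t (E : edge_set n) := [forall X : {set 'I_n},
  (0 < #|X|) && (2 * #|X| <= n) ==> (2 * (#|X| %/ t).+1 <= edge_cut E X)].

Lemma inner_edges_small n r (X : {set 'I_n}) E : E \in regular_graphs n r ->
  #|inner_edges X E| <= 'C(#|X|, 2).
Proof.
move=> /regular_graph/forall_inP gE; rewrite -cards_draws; apply/subset_leq_card/subsetP => e.
by rewrite !inE => /andP[/gE -> ->].
Qed.

(** For s < 5 the quotient by [t] is 0, and a simple graph has at most 'C(s, 2) edges inside the
    set, so at least s (r - s + 1) >= 2 edges leave it. The complete graph on 5 vertices shows that
    this fails for s = 5 and r = 4. *)
Lemma not_expanding n r t E : 4 <= r -> 5 <= t -> E \in regular_graphs n r -> ~~ expanding t E ->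
  exists X : {set 'I_n}, [/\ 5 <= #|X|, 2 * #|X| <= n &
    (r * #|X|)./2 - #|X| %/ t <= #|inner_edges X E|].
Proof.
move=> r4 t5 rE; rewrite negb_forall => /existsP[X].
rewrite negb_imply -ltnNge => /andP[/andP[X0 Xn] cX]; exists X; have ci := cut_inner X rE.
have rs : 4 * #|X| <= r * #|X| by rewrite leq_mul2r r4 orbT.
split=> //; last by move: cX ci; clear; lia.
rewrite leqNgt; apply/negP => X5; have := inner_edges_small X rE; rewrite bin2.
rewrite divn_small ?(leq_trans X5) // in cX.
move: cX ci rs X0 X5; case: #|X| => [|[|[|[|[|s]]]]] //=; clear; lia.
Qed.

(** A single term of the expansion of (L + 1)^a. It gives 'C(a, w) <= (1 + 1 / L)^a L^w, which grows
    slowly in a when w is a small fraction of a. *)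
Lemma bin_leq_exp L a w : w <= a -> 'C(a, w) * L ^ a <= L.+1 ^ a * L ^ w.
Proof.
move=> wa; have -> : L ^ a = L ^ (a - w) * L ^ w by rewrite -expnD subnK.
rewrite mulnA leq_mul2r; apply/orP; right.
have -> : L.+1 ^ a = \sum_(i < a.+1) 'C(a, i) * (L ^ (a - i) * 1 ^ i).
  by rewrite -addn1 expnDn.
rewrite (bigD1 (Ordinal (wa : w < a.+1))) //= exp1n muln1.
exact: leq_addr.
Qed.

Lemma bin_ffact_split n s k : k <= s -> 'C(n, s) * s ^_ k = n ^_ k * 'C(n - k, s - k).
Proof.
elim: k => [|k IHk] ks; first by rewrite !subn0 !ffactn0 muln1 mul1n.
rewrite !ffactnSr mulnA IHk 1?ltnW // -!mulnA; congr (_ * _).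
have -> : s - k = (s - k.+1).+1 by rewrite subnSK.
by rewrite mulnC -mul_bin_diag [n - k.+1]subnS.
Qed.

Lemma prod_even_leq_bin a b m : b <= a.*2 ->
  \prod_(i < m) (b - 2 * i) <= 'C(a, m) * \prod_(i < m) (2 * i.+1).
Proof.
move=> ba; have -> : \prod_(i < m) (2 * i.+1) = 2 ^ m * m`!.
  rewrite big_split /= prod_nat_const card_ord; congr (_ * _).
  by rewrite fact_prod big_add1 big_mkord.
rewrite mulnCA bin_ffact ffact_prod -[X in X ^ _]/2 -[m in 2 ^ m](card_ord m).
rewrite -prod_nat_const -big_split /=; apply: leq_prod => i _; lia.
Qed.

Lemma exp_leq_bin s u : s ^ u <= 'C(s + u, u) * u`!.
Proof.
rewrite bin_ffact ffact_prod -[u in s ^ u](card_ord u) -prod_nat_const.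
by apply: leq_prod => i _; have := ltn_ord i; lia.
Qed.

Local Open Scope ring_scope.

(** * Comparison of edge and vertex ratios *)

Section Ratios.
Variable R : realFieldType.

Lemma prod_unit_leq (f : nat -> R) k m : (k <= m)%N -> (forall i, 0 <= f i <= 1) ->
  \prod_(i < m) f i <= \prod_(i < k) f i.
Proof.
move=> km f01; rewrite -(subnKC km); elim: (m - k)%N => [|d IHd]; first by rewrite addn0.
rewrite addnS big_ord_recr /=; apply: le_trans IHd; rewrite ler_piMr //.
  by apply: prodr_ge0 => i _; case/andP: (f01 i).
by case/andP: (f01 (k + d)%N).
Qed.

Lemma bernoulli_inv (x : R) k : 0 <= x -> (1 + x) ^+ k * (1 - k%:R * x) <= 1.
Proof.
move=> x0; elim: k => [|k IHk]; first by rewrite expr0; lra.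
apply: le_trans IHk; rewrite exprSr -mulrA ler_wpM2l ?exprn_ge0 //; first by lra.
rewrite -natr1; have k0 : 0 <= k%:R :> R by [].
nra.
Qed.

Variables n s : nat.
Hypothesis sn : (2 * s <= n)%N.
Hypothesis s_gt0 : (0 < s)%N.

(** The product over j < s is the inverse of 'C(n, s). *)
Definition vertex_ratio j : R := (s - j)%:R / (n - j)%:R.

Lemma vertex_ratio_ge0 j : 0 <= vertex_ratio j.
Proof. by rewrite divr_ge0. Qed.

Lemma vertex_ratio_le j : vertex_ratio j <= s%:R / n%:R.
Proof.
rewrite /vertex_ratio; have [nj|jn] := leqP n j.
  by rewrite (eqP (nj : n - j == 0)%N) invr0 mulr0 divr_ge0.
rewrite ler_pdivrMr ?ltr0n ?subn_gt0 // mulrAC ler_pdivlMr ?ltr0n; last by lia.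
by rewrite -!natrM ler_nat; nia.
Qed.

Variable r : nat.

Definition edge_ratio i : R := (r * s - 2 * i)%:R / (r * n - 2 * i)%:R.

Lemma edge_ratio01 i : 0 <= edge_ratio i <= 1.
Proof.
rewrite /edge_ratio divr_ge0 //=; have [->|d0] := posnP (r * n - 2 * i)%N.
  by rewrite invr0 mulr0.
rewrite ler_pdivrMr ?ltr0n // mul1r ler_nat leq_sub2r // leq_mul2l.
by apply/orP; right; lia.
Qed.

(** [edge_ratio i] is the vertex ratio at the fractional index 2 i / r, and this ratio decreases
    with the index since s <= n. *)
Lemma edge_ratio_le i j : (j < s)%N -> (r * j <= 2 * i)%N -> edge_ratio i <= vertex_ratio j.
Proof.
move=> js ji; rewrite /edge_ratio /vertex_ratio.
have [d0|d0] := posnP (r * n - 2 * i)%N.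
  by rewrite d0 invr0 mulr0 divr_ge0.
rewrite ler_pdivrMr ?ltr0n // mulrAC ler_pdivlMr ?ltr0n; last by lia.
rewrite -!natrM ler_nat; have [e eE] : exists e, (2 * i = r * j + e)%N.
  by exists (2 * i - r * j)%N; rewrite subnKC.
rewrite eE !subnDA -!mulnBr.
have [x xE] : exists x, s = (j + x)%N by exists (s - j)%N; lia.
have [y yE] : exists y, n = (j + y)%N by exists (n - j)%N; lia.
rewrite xE yE !addKn; have xy : (x <= y)%N by lia.
have [re|er] := leqP (r * x) e; first by rewrite (eqP (re : _ - _ == 0)%N).
have -> : (x * (r * y - e) = r * x * y - x * e)%N by rewrite mulnBr mulnCA mulnA.
by rewrite mulnBl leq_sub2l // mulnC leq_mul ?xy.
Qed.

Hypothesis r_ge4 : (4 <= r)%N.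

(* Each factor [vertex_ratio k] is matched with two edge ratios, since r >= 4. *)
Lemma prod_edge_ratio k : (k <= s)%N ->
  \prod_(i < uphalf (r * k)) edge_ratio i <= \prod_(j < k) vertex_ratio j ^+ 2.
Proof.
elim: k => [|k IHk] ks; first by rewrite muln0 !big_ord0.
rewrite big_ord_recr /=; set A := uphalf (r * k).
have A0 : (r * k <= 2 * A)%N by rewrite /A; lia.
apply: le_trans (prod_unit_leq (k := A.+2) _ edge_ratio01) _; first by rewrite /A mulnS; lia.
have e0 i : 0 <= edge_ratio i by case/andP: (edge_ratio01 i).
rewrite !big_ord_recr /= -mulrA; apply: ler_pM.
- by apply: prodr_ge0.
- exact: mulr_ge0.
- exact/IHk/ltnW.
by rewrite expr2; apply: ler_pM => //; apply: edge_ratio_le => //; lia.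
Qed.

End Ratios.

Section FirstMoment.
Variable R : realFieldType.

Lemma bernoulli (x : R) k : 0 <= x -> 1 + k%:R * x <= (1 + x) ^+ k.
Proof.
move=> x0; elim: k => [|k IHk]; first by rewrite expr0; lra.
rewrite exprS; apply: le_trans (ler_wpM2l _ IHk); last by lra.
rewrite -natr1; have k0 : 0 <= k%:R :> R by []; nra.
Qed.

Lemma prod_vertex_ratio_le n s k : (2 * s <= n)%N -> (0 < s)%N ->
  \prod_(j < k) vertex_ratio R n s j <= (s%:R / n%:R) ^+ k.
Proof.
move=> sn s0; rewrite -[k in _ ^+ k]card_ord -prodr_const; apply: ler_prod => j _.
by rewrite vertex_ratio_ge0 vertex_ratio_le.
Qed.

Lemma bin_vertex_ratio n s k : (k <= s)%N -> (s <= n)%N ->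
  'C(n, s)%:R * \prod_(j < k) vertex_ratio R n s j = 'C(n - k, s - k)%:R.
Proof.
move=> ks sn; rewrite prodf_div -!natr_prod -!ffact_prod mulrA -natrM bin_ffact_split //.
rewrite natrM mulrAC divff ?mul1r // pnatr_eq0 -lt0n ffact_gt0; lia.
Qed.

Lemma bin_exp_le n u : 'C(n, u)%:R <= n%:R ^+ u / u`!%:R :> R.
Proof.
rewrite ler_pdivlMr ?ltr0n ?fact_gt0 // -natrM -natrX ler_nat bin_ffact ffact_prod.
rewrite -[u in (n ^ u)%N](card_ord u) -prod_nat_const.
by apply: leq_prod => i _; apply: leq_subr.
Qed.

Lemma bin_le_rate L a w : (0 < L)%N -> (w <= a)%N ->
  'C(a, w)%:R <= (L.+1%:R / L%:R) ^+ a * L%:R ^+ w :> R.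
Proof.
move=> L0 wa; rewrite expr_div_n mulrAC ler_pdivlMr ?exprn_gt0 ?ltr0n //.
by rewrite -!natrX -!natrM ler_nat bin_leq_exp.
Qed.

(* The binomial absorbs one of the two products up to a binomial of index u. *)
Lemma bin_vertex_ratio2 L n s u : (0 < L)%N -> (2 * u <= s)%N -> (2 * s <= n)%N -> (0 < s)%N ->
  'C(n, s)%:R * (\prod_(j < s - u) vertex_ratio R n s j) ^+ 2 <=
  (L.+1%:R / L%:R) ^+ (s + u) * L%:R ^+ u * (s%:R / n%:R) ^+ (s - 2 * u).
Proof.
move=> L0 us sn s0; have n0 : (0 < n)%N by lia.
rewrite expr2 mulrA bin_vertex_ratio; [|lia|lia].
have Q0 : 0 <= \prod_(j < s - u) vertex_ratio R n s j.
  by apply: prodr_ge0 => j _; apply: vertex_ratio_ge0.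
have -> : (s - (s - u) = u)%N by lia.
have H1 : 'C(n - (s - u), u)%:R <= n%:R ^+ u / u`!%:R :> R.
  apply: le_trans (bin_exp_le _ _) _; rewrite ler_pM2r ?invr_gt0 ?ltr0n ?fact_gt0 //.
  by rewrite lerXn2r ?nnegrE // ler_nat leq_subr.
have H2 := prod_vertex_ratio_le (s - u) sn s0.
apply: le_trans (ler_pM _ Q0 H1 H2) _ => //.
have -> : (s - u = u + (s - 2 * u))%N by lia.
rewrite exprD mulrA ler_wpM2r ?exprn_ge0 ?divr_ge0 //.
have -> : n%:R ^+ u / u`!%:R * (s%:R / n%:R) ^+ u = s%:R ^+ u / u`!%:R :> R.
  have : n%:R ^+ u != 0 :> R by rewrite expf_neq0 // pnatr_eq0 -lt0n.
  have : u`!%:R != 0 :> R by rewrite pnatr_eq0 -lt0n fact_gt0.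
  rewrite expr_div_n; move: (n%:R ^+ u) (u`!%:R) (s%:R ^+ u) => x y z y0 x0.
  by field; rewrite x0 y0.
apply: le_trans (bin_le_rate L0 (leq_addl s u)).
by rewrite ler_pdivrMr ?ltr0n ?fact_gt0 // -natrX -natrM ler_nat exp_leq_bin.
Qed.

(** One copy of the factors r s - 2 i is absorbed by the factors 2 (i + 1), leaving 'C(a, m) = 'C(a,
    a - m) of small index; the other copy gives the edge ratios. As n >= (L + 1) c, dropping [c]
    costs a factor 1 + 1 / L each time. *)
Lemma dense_ratio_le L c r n s m : (0 < L)%N -> (L.+1 * c <= n)%N -> (4 <= r)%N ->
  (2 * s <= n)%N -> (0 < s)%N -> (2 * m <= r * s)%N ->
  (\prod_(i < m) (r * s - 2 * i) ^ 2)%:R <=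
  (L.+1%:R / L%:R) ^+ (uphalf (r * s) + m) * L%:R ^+ (uphalf (r * s) - m) *
  \prod_(i < m) edge_ratio R n s r i *
  (\prod_(i < m) (2 * i.+1 * (r * n - 2 * i - c)))%:R.
Proof.
move=> L0 cn r4 sn s0 ms; set a := uphalf (r * s); set q := L.+1%:R / L%:R.
have ma : (m <= a)%N by rewrite /a; lia.
have rate i : (i < m)%N -> (r * n - 2 * i)%:R <= q * (r * n - 2 * i - c)%:R :> R.
  move=> im; rewrite /q mulrAC ler_pdivlMr ?ltr0n // -!natrM ler_nat.
  have ny : (n <= r * n - 2 * i)%N by nia.
  move: (r * n - 2 * i)%N ny => y ny; rewrite mulnBr leq_subRL; first by lia.
  by rewrite leq_mul2l; nia.
have N1 : (\prod_(i < m) (r * s - 2 * i) ^ 2)%:R <=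
    'C(a, m)%:R * (\prod_(i < m) (2 * i.+1))%:R * (\prod_(i < m) (r * s - 2 * i))%:R :> R.
  have -> : (\prod_(i < m) (r * s - 2 * i) ^ 2 =
      \prod_(i < m) (r * s - 2 * i) * \prod_(i < m) (r * s - 2 * i))%N.
    by rewrite -big_split /=; apply: eq_bigr => i _.
  by rewrite -!natrM ler_nat leq_mul2r prod_even_leq_bin ?orbT // /a; lia.
have N2 : (\prod_(i < m) (r * s - 2 * i))%:R <=
    \prod_(i < m) edge_ratio R n s r i * (q ^+ m * (\prod_(i < m) (r * n - 2 * i - c))%:R) :> R.
  rewrite -[m in q ^+ m](card_ord m) -prodr_const !natr_prod -!big_split /=.
  apply: ler_prod => i _; rewrite ler0n /=.
  have d0 : (0 < r * n - 2 * i)%N by have := ltn_ord i; nia.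
  rewrite -[leLHS](@divfK _ (r * n - 2 * i)%:R) ?pnatr_eq0 -?lt0n //.
  by rewrite ler_wpM2l ?rate // divr_ge0.
apply: le_trans N1 _; apply: le_trans (ler_wpM2l _ N2) _; first by rewrite mulr_ge0.
have -> : (\prod_(i < m) (2 * i.+1 * (r * n - 2 * i - c)) =
   \prod_(i < m) (2 * i.+1) * \prod_(i < m) (r * n - 2 * i - c))%N by rewrite big_split.
have := bin_le_rate L0 (leq_subr m a); rewrite bin_sub // -/q => Ca.
rewrite natrM exprD.
set A := (_%:R : R) in Ca *; set B := (\prod_(i < m) (2 * _))%:R.
set G := \prod_(i < m) edge_ratio _ _ _ _ _.
set D := (\prod_(i < m) _)%:R; set F := L%:R ^+ _ in Ca *.
have -> : A * B * (G * (q ^+ m * D)) = A * (B * G * q ^+ m * D) by ring.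
have -> : q ^+ a * q ^+ m * F * G * (B * D) = q ^+ a * F * (B * G * q ^+ m * D) by ring.
apply: ler_wpM2r Ca; rewrite !mulr_ge0 ?exprn_ge0 ?divr_ge0 //.
by apply: prodr_ge0 => i _; case/andP: (edge_ratio01 R sn s0 r i).
Qed.

End FirstMoment.

Section DensityTerm.
Variable R : realFieldType.

Lemma rate_le r L : L = (5 * (2 * r + 2))%N -> (L.+1%:R / L%:R) ^+ (2 * r + 2) <= 5 / 4 :> R.
Proof.
move=> LE; have L0 : 0 < L%:R :> R by rewrite ltr0n; lia.
have -> : L.+1%:R / L%:R = 1 + L%:R^-1 :> R by rewrite -natr1; field; rewrite gt_eqF.
have := @bernoulli_inv R L%:R^-1 (2 * r + 2) _; rewrite invr_ge0 ler0n => /(_ isT).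
have -> : (2 * r + 2)%:R * L%:R^-1 = 1 / 5 :> R.
  have : (2 * r + 2)%:R != 0 :> R by rewrite pnatr_eq0; lia.
  by rewrite LE natrM; move: (2 * r + 2)%:R => x x0; field.
lra.
Qed.

(* L makes the accumulated (1 + 1 / L)-powers at most (5 / 4) ^ s, and t makes the powers of L
   with exponent O(s / t) at most (5 / 4) ^ s; the factor s costs another (5 / 4) ^ s, and
   (5 / 4) ^ 3 / 2 = 125 / 128. *)
Lemma density_term_le r L t n s c :
  L = (5 * (2 * r + 2))%N -> t = (16 * L ^ 2)%N -> (4 <= r)%N -> (L.+1 * c <= n)%N ->
  (5 <= s)%N -> (2 * s <= n)%N ->
  ('C(n, s) * \prod_(i < (r * s)./2 - s %/ t) (r * s - 2 * i) ^ 2)%:R * n%:R <=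
  (32 * L ^ 2)%:R * (125 / 128) ^+ s *
  (\prod_(i < (r * s)./2 - s %/ t) (2 * i.+1 * (r * n - 2 * i - c)))%:R :> R.
Proof.
move=> LE tE r4 cn s5 sn.
have s0 : (0 < s)%N by lia.
have n0 : (0 < n)%N by lia.
have L0 : (0 < L)%N by lia.
have L40 : (40 <= L)%N by lia.
have t100 : (100 <= t)%N by rewrite tE; nia.
(* [m] is the number of edges inside a set that fails to expand. It falls short of r s / 2 by about
   [k], so [u] of the vertex factors are given up; the successor accounts for rounding. *)
set k := (s %/ t)%N; set m := ((r * s)./2 - k)%N; set u := k.+1; set a := uphalf (r * s).
have kt : (k * t <= s)%N by apply: leq_trunc_div.
have k100 : (100 * k <= s)%N by apply: leq_trans kt; rewrite mulnC leq_mul2l t100 orbT.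
have rs4 : (4 * s <= r * s)%N by rewrite leq_mul2r r4 orbT.
have us : (2 * u < s)%N by rewrite /u; clear -k100 s5; lia.
have mE : (a + m + (s + u) <= (2 * r + 2) * s)%N.
  by rewrite /a /m /u; clear -k100 s5 rs4; lia.
have wE : (a - m + u <= 2 + 2 * k)%N by rewrite /a /m /u; clear -k100 s5 rs4; lia.
set q := L.+1%:R / L%:R : R.
have q1 : 1 <= q by rewrite /q ler_pdivlMr ?ltr0n // mul1r ler_nat.
have q0 : 0 <= q by apply: le_trans q1.
set Q := \prod_(j < s - u) vertex_ratio R n s j.
have e01 := edge_ratio01 R sn s0 r.
have edges_le : \prod_(i < m) edge_ratio R n s r i <= Q ^+ 2.
  rewrite -prodrXl.
  apply: le_trans (prod_edge_ratio R sn s0 r4 (leq_subr u s)).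
  apply: prod_unit_leq => //; rewrite mulnBr.
  have ru : (4 * u <= r * u)%N by rewrite leq_mul2r r4 orbT.
  by rewrite /m; clear -ru k100 s5 rs4; lia.
have q54 : q ^+ (a + m + (s + u)) <= (5 / 4) ^+ s.
  apply: (@le_trans _ _ (q ^+ ((2 * r + 2) * s))); first exact: ler_weXn2l.
  by rewrite exprM lerXn2r ?nnegrE ?exprn_ge0 ?(rate_le LE) //; lra.
have Lw : L%:R ^+ (a - m + u) <= L%:R ^+ 2 * (L%:R ^+ 2) ^+ k :> R.
  by rewrite -exprM -exprD ler_weXn2l // ler1n.
have L4 : (4 * L%:R ^+ 2) ^+ k <= (5 / 4) ^+ s :> R.
  apply: (@le_trans _ _ ((5 / 4) ^+ (t * k))).
    rewrite exprM lerXn2r ?nnegrE ?mulr_ge0 ?exprn_ge0 //; try lra.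
    have -> : 5 / 4 = 1 + 1 / 4 :> R by field.
    apply: le_trans (@bernoulli R (1 / 4) t _); last by lra.
    rewrite tE natrM natrX; have : 0 <= L%:R ^+ 2 :> R by rewrite exprn_ge0.
    by move: (L%:R ^+ 2 : R) => y; lra.
  by rewrite ler_weXn2l //; [lra | rewrite mulnC].
have s54 : s%:R <= 4 * (5 / 4) ^+ s :> R.
  have := @bernoulli R (1 / 4) s _; have -> : 1 + 1 / 4 = 5 / 4 :> R by field.
  by move=> /(_ ltac:(lra)); move: (_ ^+ s) => y; lra.
(* One factor s / n is kept, since it supplies the final 1 / n; the others are bounded by 1 / 2. *)
have sn2 : (s%:R / n%:R) ^+ (s - 2 * u) <= s%:R / n%:R * (8 * 4 ^+ k / 2 ^+ s) :> R.
  have -> : (s - 2 * u = (s - 2 * u).-1.+1)%N by clear -us; lia.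
  rewrite exprS ler_wpM2l ?divr_ge0 //.
  apply: (@le_trans _ _ ((1 / 2) ^+ (s - 2 * u).-1)).
    rewrite lerXn2r ?nnegrE ?divr_ge0 //.
    rewrite ler_pdivrMr ?ltr0n // mulrC mulrA ler_pdivlMr ?ltr0n // mulr1 -natrM ler_nat mulnC.
    by [].
  set v := (s - 2 * u).-1; have -> : 2 ^+ s = 2 ^+ v * 2 ^+ (2 * k + 3) :> R.
    by rewrite -exprD; congr (_ ^+ _); rewrite /v /u; clear -us; lia.
  rewrite ler_pdivlMr ?mulr_gt0 ?exprn_gt0 // mulrA.
  rewrite -exprMn mul1r mulVf ?pnatr_eq0 // expr1n mul1r exprD exprM.
  have e4 : 2 ^+ 2 = 4 :> R by ring.
  have e8 : 2 ^+ 3 = 8 :> R by ring.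
  by rewrite e4 e8 mulrC.
have N0 : 0 < n%:R :> R by rewrite ltr0n.
rewrite natrM.
have P0 : 0 <= (\prod_(i < m) (2 * i.+1 * (r * n - 2 * i - c)))%:R :> R by [].
have ms : (2 * m <= r * s)%N by rewrite /m; clear; lia.
have := dense_ratio_le R L0 cn r4 sn s0 ms; rewrite -/a -/q.
move: P0; move: (\prod_(i < m) (2 * _ * _))%:R => P P0.
move: (\prod_(i < m) (_ ^ 2))%:R => N HN.
have := bin_vertex_ratio2 R L0 (ltnW us) sn s0; rewrite -/Q -/q => HC.
set C := 'C(n, s)%:R in HC *; have C0 : 0 <= C by [].
set G := \prod_(i < m) _ in HN edges_le.
have step1 : C * N <=
    q ^+ (a + m + (s + u)) * L%:R ^+ (a - m + u) * (s%:R / n%:R) ^+ (s - 2 * u) * P.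
  apply: le_trans (ler_wpM2l C0 HN) _.
  apply: (@le_trans _ _ (q ^+ (a + m) * L%:R ^+ (a - m) * (C * Q ^+ 2) * P)).
    rewrite [leRHS](_ : _ = C * (q ^+ (a + m) * L%:R ^+ (a - m) * Q ^+ 2 * P)); last by ring.
    by rewrite !ler_wpM2l // ler_wpM2r // ler_wpM2l // mulr_ge0 ?exprn_ge0.
  rewrite !exprD ler_wpM2r //.
  rewrite [leRHS](_ : _ = q ^+ a * q ^+ m * L%:R ^+ (a - m) *
    (q ^+ s * q ^+ u * L%:R ^+ u * (s%:R / n%:R) ^+ (s - 2 * u))); last by ring.
  by rewrite ler_wpM2l ?mulr_ge0 ?exprn_ge0 // -exprD.
apply: (@le_trans _ _ (((5 / 4) ^+ s * (L%:R ^+ 2 * (L%:R ^+ 2) ^+ k) *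
   (s%:R / n%:R * (8 * 4 ^+ k / 2 ^+ s)) * P) * n%:R)).
  apply: ler_wpM2r; first exact: ltW.
  apply: le_trans step1 _; apply: ler_wpM2r => //.
  by rewrite !ler_pM ?mulr_ge0 ?exprn_ge0 ?divr_ge0.
rewrite [leLHS](_ : _ = 8 * L%:R ^+ 2 * P * ((5 / 4) ^+ s / 2 ^+ s) *
  (s%:R * (4 * L%:R ^+ 2) ^+ k)); last first.
  rewrite [(4 * _) ^+ k]exprMn; field.
  by rewrite expf_neq0 ?pnatr_eq0 -?lt0n // gt_eqF.
have F0 : 0 <= 8 * L%:R ^+ 2 * P * ((5 / 4) ^+ s / 2 ^+ s) :> R.
  by rewrite !mulr_ge0 ?exprn_ge0 ?invr_ge0 ?exprn_ge0 //; lra.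
apply: le_trans (ler_wpM2l F0 (ler_pM (ler0n _ _) _ s54 L4)) _.
  by rewrite exprn_ge0 // mulr_ge0 // exprn_ge0.
rewrite -expr_div_n natrM natrX.
rewrite [leLHS](_ : _ = 32 * L%:R ^+ 2 *
  (((5 / 4) / 2) ^+ s * (5 / 4) ^+ s * (5 / 4) ^+ s) * P); last by ring.
rewrite -!exprMn (_ : 5 / 4 / 2 * (5 / 4) * (5 / 4) = 125 / 128 :> R) //; by field.
Qed.

End DensityTerm.

Section Union.
Variable R : realFieldType.

Lemma geometric_sum_le k : \sum_(i < k) (125 / 128) ^+ i <= 128 / 3 :> R.
Proof.
have := subrX1 (125 / 128 : R) k; have : 0 <= (125 / 128) ^+ k :> R by apply: exprn_ge0; lra.
move: (\sum_(i < k) _) (_ ^+ k) => x y; lra.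
Qed.

Lemma sum_card (n : nat) (P : pred nat) (f : nat -> R) :
  \sum_(X : {set 'I_n} | P #|X|) f #|X| = \sum_(s < n.+1 | P s) 'C(n, s)%:R * f s.
Proof.
have cX (X : {set 'I_n}) : (#|X| < n.+1)%N by rewrite ltnS -[leqRHS]card_ord max_card.
rewrite (partition_big (fun X : {set 'I_n} => Ordinal (cX X)) (fun s : 'I_n.+1 => P s)) //=.
apply: eq_bigr => s Ps.
rewrite (eq_bigr (fun=> f s)); last by move=> X /andP[_ /eqP <-].
rewrite sumr_const -[LHS]mulr_natl; congr (_%:R * _).
have := card_draws 'I_n s; rewrite card_ord => <-.
apply: eq_card => X; rewrite inE unfold_in; apply/andP/eqP => [[_ /eqP <-] //|Xs].
by split; [rewrite Xs | apply/eqP/val_inj].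
Qed.

Lemma card_not_expanding n r L : L = (5 * (2 * r + 2))%N -> (4 <= r)%N ->
  (L.+1 * (2 * (r * r.+1) + 2) <= n)%N ->
  #|[set E in regular_graphs n r | ~~ expanding (16 * L ^ 2) E]|%:R * n%:R <=
  (32 * L ^ 2)%:R * (128 / 3) * #|regular_graphs n r|%:R :> R.
Proof.
(* [c] collects the excluded switchings and the 2 by which 2 (i + 1) exceeds 2 i. *)
move=> LE r4 cn; set t := (16 * L ^ 2)%N; set c := (2 * (r * r.+1) + 2)%N in cn.
have t5 : (5 <= t)%N by rewrite /t LE; clear -r4; nia.
have n0 : (0 < n)%N by apply: leq_trans cn; rewrite /c; clear; nia.
pose m s := ((r * s)./2 - s %/ t)%N.
pose D (X : {set 'I_n}) := [set E in regular_graphs n r | (m #|X| <= #|inner_edges X E|)%N].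
pose P (s : nat) := ((5 <= s) && (2 * s <= n))%N.
pose num s := (\prod_(i < m s) (r * s - 2 * i) ^ 2)%N.
pose den s := (\prod_(i < m s) (2 * i.+1 * (r * n - 2 * i - c)))%N.
set G := #|regular_graphs n r|.
have bound : (#|[set E in regular_graphs n r | ~~ expanding t E]| <=
    \sum_(X : {set 'I_n} | P #|X|) #|D X|)%N.
  apply: leq_trans (card_bigcup_leq _ D); apply/subset_leq_card/subsetP => E.
  rewrite inE => /andP[rE nE]; have [X [X5 Xn dX]] := not_expanding r4 t5 rE nE.
  by apply/bigcupP; exists X; rewrite /P ?X5 // inE rE.
have den0 s : P s -> (0 < den s)%N.
  move=> /andP[s5 sn]; apply: prodn_gt0 => i; rewrite muln_gt0 /= subn_gt0.
  move: (nat_of_ord i) (ltn_ord i) => j; rewrite /m => im.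
  have rsn : (r * (2 * s) <= r * n)%N by rewrite leq_mul2l sn orbT.
  have rn : (4 * n <= r * n)%N by rewrite leq_mul2r r4 orbT.
  have L1 : (2 * c <= L.+1 * c)%N by rewrite leq_mul2r LE; clear; lia.
  rewrite ltn_subRL; move: (s %/ t)%N im cn n0 L1 rsn rn; rewrite mulnCA.
  move: (L.+1 * c)%N (r * n)%N (r * s)%N; clear; lia.
have DX (X : {set 'I_n}) : P #|X| -> #|D X|%:R <= G%:R * ((num #|X|)%:R / (den #|X|)%:R) :> R.
  move=> /den0 d0; rewrite mulrA ler_pdivlMr ?ltr0n // -!natrM ler_nat.
  have := dense_product r X (m #|X|).
  rewrite (eq_bigr (fun i : 'I_(m #|X|) => (2 * i.+1 * (r * n - 2 * i - c))%N)) // => i _.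
  by congr (_ * _)%N; rewrite /c; clear; lia.
apply: (@le_trans _ _ (\sum_(X : {set 'I_n} | P #|X|)
  G%:R * ((num #|X|)%:R / (den #|X|)%:R) * n%:R)).
  rewrite -mulr_suml ler_wpM2r //; apply: le_trans (ler_sum _ DX).
  by rewrite -natr_sum ler_nat.
rewrite (sum_card n P (fun s => G%:R * ((num s)%:R / (den s)%:R) * n%:R)).
apply: (@le_trans _ _ (\sum_(s < n.+1 | P s) (32 * L ^ 2)%:R * G%:R * (125 / 128) ^+ s)).
  apply: ler_sum => s Ps; have d0 := den0 _ Ps; case/andP: (Ps) => s5 sn.
  have := density_term_le R LE (erefl t) r4 cn s5 sn; rewrite -/(m s) -/(num s) -/(den s) natrM.
  move: d0; rewrite -(ltr0n R); move: (den s)%:R (num s)%:R 'C(n, s)%:R => x y z x0 le.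
  rewrite [leLHS](_ : _ = z * y * n%:R / x * G%:R); last by ring.
  by rewrite [leRHS]mulrAC ler_wpM2r // ler_pdivrMr.
rewrite -mulr_sumr [leRHS]mulrAC ler_wpM2l ?mulr_ge0 //.
apply: le_trans (geometric_sum_le n.+1).
by rewrite big_mkcond ler_sum // => s _; case: ifP => // _; apply: exprn_ge0; lra.
Qed.

End Union.

From mathcomp Require Import all_classical all_reals all_analysis.
Import Order.TTheory GRing.Theory Num.Theory.
Import numFieldNormedType.Exports.
Local Open Scope classical_set_scope.
Local Open Scope ring_scope.

(** * Conclusion *)

Lemma rc_le (R : realType) n (E : edge_set n) k (x : R) :
  rainbow_colorable E k -> k%:R <= x -> (rc R E <= x%:E)%E.
Proof.
move=> Ek kx; apply: (@le_trans _ _ (k%:R)%:E); last by rewrite lee_fin.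
by apply: ereal_inf_lbound; exists k.
Qed.

Lemma trunc_log_le_ln (R : realType) n : (2 <= n)%N ->
  (trunc_log 2 n).+1%:R * ln (2 : R) <= 2 * ln n%:R.
Proof.
move=> n2; have n0 : (0 < n)%N by apply: leq_trans n2.
have le1 : ln (2 : R) <= ln n%:R by rewrite ler_ln ?posrE ?ltr0n // ler_nat.
have le2 : (trunc_log 2 n)%:R * ln (2 : R) <= ln n%:R.
  rewrite mulr_natl -lnXn // ler_ln ?posrE ?exprn_gt0 ?ltr0n // -natrX ler_nat.
  exact: trunc_logP.
by rewrite -natr1 mulrDl mul1r [leRHS]mulr_natl mulr2n lerD.
Qed.

Lemma expanding_rc_le (R : realType) n r t (E : edge_set n) (W := (t * (2 * r * r * t))%N) :
  (0 < r)%N -> (0 < t)%N -> (2 * r <= n)%N -> E \in regular_graphs n r -> expanding t E ->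
  (rc R E <= ((6 * r * t + 4 + (2 * W).+2 * (2 * r * W))%:R * (2 / ln 2) * ln n%:R)%:E)%E.
Proof.
move=> r0 t0 rn rE xE.
have maxdeg x : (#|[set y | adj E x y]%SET| <= r)%N by rewrite (regular_adj x rE).
have expands (X : {set 'I_n}) : (0 < #|X|)%N -> (2 * #|X| <= n)%N ->
    (2 * (#|X| %/ t).+1 <= edge_cut E X)%N.
  by move=> X0 Xn; move/forallP/(_ X): xE; rewrite X0 Xn.
have M0 : (0 < 2 * r * r * t)%N by rewrite !muln_gt0 r0 t0.
apply: rc_le (expander_rainbow maxdeg t0 expands r0 M0 rn erefl) _.
have n2 : (2 <= n)%N by apply: leq_trans rn; rewrite -[X in (X <= _)%N]muln1 leq_mul2l.
have ln2 : 0 < ln (2 : R) by rewrite ln_gt0 // ltr1n.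
(* The core takes 6 r t N + 4 colors for N = [(trunc_log 2 n).+1], and 4 <= 4 N. *)
apply: (@le_trans _ _
    ((6 * r * t + 4 + (2 * W).+2 * (2 * r * W)) * (trunc_log 2 n).+1)%:R).
  rewrite ler_nat /half_radius -/W -(mulnA 6).
  move: ((2 * W).+2 * (2 * r * W))%N (trunc_log _ _) => y T.
  by move: (r * t)%N => z; clear; nia.
rewrite natrM -[leRHS]mulrA ler_wpM2l // [leRHS]mulrAC ler_pdivlMr //.
exact: trunc_log_le_ln.
Qed.

Theorem theorem1 (R : realType) (r : nat) (hr : (4 <= r)%N) :
  exists C : R,
    Pr_regular R r [set E : edge_set n | (rc R E <= (C * ln (n%:R : R))%:E)%E]%SET
      @[n --> within [set n : nat | ~~ odd (r * n)] \oo] --> (1 : R).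
Proof.
have r0 : (0 < r)%N by apply: leq_trans hr.
pose L := (5 * (2 * r + 2))%N; pose t := (16 * L ^ 2)%N.
have t0 : (0 < t)%N by rewrite muln_gt0 expn_gt0 /L addn2.
pose W := (t * (2 * r * r * t))%N.
pose B : R := (32 * L ^ 2)%:R * (128 / 3).
exists ((6 * r * t + 4 + (2 * W).+2 * (2 * r * W))%:R * (2 / ln 2)).
apply/cvgrPdist_lt => e e0; rewrite near_withinE; near=> n => rn.
have n_large : (L.+1 * (2 * (r * r.+1) + 2) <= n)%N by near: n; apply: nbhs_infty_ge.
(* The probability of failure is at most B / n. *)
have n_gt : B / e < n%:R by near: n; apply: nbhs_infty_gtr.
have rn2 : (2 * r < n)%N by apply: leq_trans n_large; clear; nia.
have G0 : (0 < #|regular_graphs n r|)%N.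
  by apply: regular_graphs_neq0 => //; apply: leq_ltn_trans rn2; rewrite leq_pmull.
rewrite /Pr_regular; set A := [set E : edge_set n | _]%SET.
set G := regular_graphs n r in G0 *.
have bad : (#|G :\: A| <= #|[set E in G | ~~ expanding t E]%SET|)%N.
  apply/subset_leq_card/fintype.subsetP => E; rewrite finset.in_setD => /andP[nA rE].
  rewrite finset.in_set rE /=; apply: contra nA => xE; rewrite finset.in_set.
  by apply: expanding_rc_le => //; apply: ltnW.
have small := card_not_expanding R (erefl L) hr n_large.
have n0 : 0 < n%:R :> R by rewrite ltr0n; apply: leq_ltn_trans rn2.
have G0R : 0 < #|G|%:R :> R by rewrite ltr0n.
have -> : 1 - #|G :&: A|%:R / #|G|%:R = #|G :\: A|%:R / #|G|%:R :> R.
  rewrite -[X in X - _](divff (lt0r_neq0 G0R)) -mulrBl; congr (_ / _).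
  by rewrite -{1}(cardsID A G) natrD addrAC subrr add0r.
rewrite ger0_norm ?divr_ge0 // ltr_pdivrMr // -(ltr_pM2r n0).
rewrite ltr_pdivrMr // in n_gt.
apply: (@le_lt_trans _ _ (B * #|G|%:R)).
  by apply: le_trans small; rewrite ler_wpM2r // ler_nat.
by rewrite [ltRHS]mulrAC ltr_pM2r // mulrC.
Unshelve. all: by end_near.
Qed.
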